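(* For all integers $n\ge0$, $$b(6n+3)\equiv 0\pmod 6,\qquad b(36n+22)\equiv 0\pmod{36},\qquad b(12n+9)\equiv 0\pmod{54}.$$
   Context: The mock theta function $\mathcal{B}(q)=\sum_{n\ge0}\frac{q^n(-q;q^2)_n}{(q;q^2)_{n+1}}=\sum_{n\ge0}b(n)q^n$, where $(a;q)_n=\prod_{j=0}^{n-1}(1-aq^j)$. *)

(* Defs.v *)
From HB Require Import structures.
From mathcomp Require Import all_boot all_order all_algebra.
Set Implicit Arguments. Unset Strict Implicit. Unset Printing Implicit Defensive.
Import Order.TTheory GRing.Theory Num.Theory.
Local Open Scope ring_scope.

(* Truncation of the geometric series 1/(1 - q^m) modulo q^(N+1):
   sum_{i=0}^{N} q^(m i). *)
Definition geom_trunc (m N : nat) : {poly int} :=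
  \sum_(i < N.+1) 'X^(m * i).

Definition negq_poch (k : nat) : {poly int} :=
  \prod_(j < k) (1 + 'X^(2 * j + 1)).

(* 1/(q;q^2)_{k+1} = prod_{j<=k} 1/(1 - q^(2j+1)), truncated modulo q^(N+1). *)
Definition inv_q_poch_trunc (k N : nat) : {poly int} :=
  \prod_(j < k.+1) geom_trunc (2 * j + 1) N.

(* b(n) = coefficient of q^n in B(q) = sum_{k>=0} q^k (-q;q^2)_k / (q;q^2)_{k+1}.
   Only terms k <= n contribute to q^n, and all series are truncated
   modulo q^(n+1), which does not change the coefficient of q^n. *)
Definition b (n : nat) : int :=
  (\sum_(k < n.+1) 'X^k * negq_poch k * inv_q_poch_trunc k n)`_n.

(* Main.v *)
(** Everything is computed modulo [q^N], so that [q] is nilpotent and all series are finite sums.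
    Put [phi(q) = sum q^(n^2)], [psi(q) = sum q^(2n^2+n)],
    [T(q) = sum (-1)^n q^(n^2+n)/(1-q^(2n+1))] and [S(q) = sum (-1)^n q^(n^2+2n)/(1-q^(2n+1))],
    all sums over the integers.  A transformation of Fine and two Bailey pairs give
    [phi(-q^2) B(q) = T(q^2) + q S(q^2)].  Multiplying a theta series by an Appell sum and
    collecting the terms with a fixed sum of the two indices produces sums that satisfy one-term
    recurrences; in this way one gets [T = psi^2] and
    [phi(q) S(q) = 2 psi(q^2)^3 + odd powers of q].  Modulo 4, [phi^2 = 1], which yields
    [4 | b(4n+2)].

    Write [phi(-q) = a - 2 q w] and [psi(q) = A + q P] with [a, w, A, P] series in [q^3].
    Then [A w = a P], and [(a - 2qw)(a^2 + 2aqw + 4q^2w^2)] is a series in [q^3], so after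
    multiplying by [c = a^2 + 2aqw + 4q^2w^2] the residue classes mod 3 separate.  The [q^(3m+2)]
    part of [c psi^2] is [q^2 (2Aw + aP)^2 = 9 q^2 (Aw)^2], that of [c^2 psi^3] is divisible
    by 27, and the [q^(3m+1)] part of [c S] is divisible by 6 because of two identities between
    Lambert series. *)
Require Import Defs.
From mathcomp Require Import all_boot all_order all_algebra.
From mathcomp Require Import zify ring.
From mathcomp Require Import qpoly.
Set Implicit Arguments. Unset Strict Implicit. Unset Printing Implicit Defensive.
Import Order.TTheory GRing.Theory Num.Theory.
Import Pdiv.CommonRing Pdiv.RingMonic.
Local Open Scope ring_scope.

(** * Finite bilateral sums *)

(** The theta and Appell identities are proved for a nilpotent [q] in a commutative ring, so the
    substitutions [-q], [q^2], [q^3] are plain instantiations. The price is that negative powers of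
    [q] do not exist: Appell terms must stay [valid] under every shift, and each reindexing needs a
    support bound. The one-term recurrences for Appell sums come from
    [q^e/(1-q^m) = q^e + q^(e+m)/(1-q^m)]: the extra monomials cancel under a reflection of the
    summation index. With [y = q^2], [psi(y)^2] contributes only even exponents and [q S(y)] only
    odd ones. Hence [6n+4 = 2(3n+2)] sees the class 2 mod 3 of [psi(y)^2], [6n+3 = 1+2(3n+1)] the
    class 1 of [S(y)], and [12n+9 = 1+4(3n+2)] the class 2 of [psi(y^2)^3]. The multipliers are
    harmless in the end: each is a series in [q^d], where [d] is the modulus of the progression,
    with constant term 1. *)

Definition zrange (B : nat) : seq int :=
  [seq Posz i | i <- iota 0 B] ++ [seq Negz i | i <- iota 0 B].

Lemma mem_zrange B (n : int) : (n \in zrange B) = (- B%:Z <= n < B%:Z).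
Proof.
rewrite mem_cat; apply/orP/idP => [[] /mapP[i] | ].
- by rewrite mem_iota => hi ->; lia.
- by rewrite mem_iota => hi ->; lia.
case: n => n hn; [left | right]; apply/mapP; exists n => //; rewrite mem_iota; lia.
Qed.

Lemma zrange_uniq B : uniq (zrange B).
Proof.
rewrite cat_uniq !map_inj_uniq ?iota_uniq; try by move=> i j [].
rewrite andbT /=; apply/hasPn => _ /mapP[i _ ->]; apply/mapP => -[j _]; lia.
Qed.

(* Large enough to contain, when [q^N = 0], the supports of all families summed below and
   their images under the substitutions used to reindex them. *)
Definition zbox (N : nat) : nat := 100 * N.+1.
Arguments zbox N : simpl never.
Arguments zrange B : simpl never.

Section BilateralSums.
Variables (R : comNzRingType) (N : nat).

Definition zsum (f : int -> R) : R := \sum_(n <- zrange (zbox N)) f n.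

Lemma eq_zsum (f g : int -> R) : (forall n, f n = g n) -> zsum f = zsum g.
Proof. by move=> h; apply: eq_bigr => n _. Qed.

Lemma zsumD (f g : int -> R) : zsum (fun n => f n + g n) = zsum f + zsum g.
Proof. exact: big_split. Qed.

Lemma zsumN (f : int -> R) : zsum (fun n => - f n) = - zsum f.
Proof. by rewrite /zsum sumrN. Qed.

Lemma zsumB (f g : int -> R) : zsum (fun n => f n - g n) = zsum f - zsum g.
Proof. by rewrite zsumD zsumN. Qed.

Lemma zsumMl c (f : int -> R) : zsum (fun n => c * f n) = c * zsum f.
Proof. by rewrite /zsum mulr_sumr. Qed.

Lemma zsumMr c (f : int -> R) : zsum (fun n => f n * c) = zsum f * c.
Proof. by rewrite /zsum mulr_suml. Qed.

Lemma zsum_mul (f g : int -> R) :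
  zsum f * zsum g = zsum (fun m => zsum (fun n => f m * g n)).
Proof. by rewrite -zsumMr; apply: eq_zsum => m; rewrite zsumMl. Qed.

Definition inbox (n : int) := - (zbox N)%:Z <= n < (zbox N)%:Z.

Lemma big_supp (T : eqType) (s : seq T) (f : T -> R) :
  \sum_(i <- s) f i = \sum_(i <- [seq j <- s | f j != 0]) f i.
Proof.
rewrite big_filter [LHS](bigID (fun i => f i != 0)) /= [X in _ + X]big1 ?addr0 //.
by move=> i /negbNE/eqP.
Qed.

Lemma big_reindex_supp (T : eqType) (s t : seq T) (f : T -> R) :
  uniq s -> uniq t -> (forall i, f i != 0 -> (i \in s) = (i \in t)) ->
  \sum_(i <- s) f i = \sum_(i <- t) f i.
Proof.
move=> us ut h; rewrite big_supp [RHS]big_supp; apply: perm_big.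
apply: uniq_perm; rewrite ?filter_uniq // => i; rewrite !mem_filter.
by case hi: (f i != 0) => //=; apply: h.
Qed.

(** The box need not be stable under [h]. Indices of nonzero terms lie in the box together with
    their images under [h'], so both sides run over the same support. *)
Lemma zsum_reindex (h h' : int -> int) (f : int -> R) :
  cancel h h' -> cancel h' h ->
  (forall n, f n != 0 -> inbox n && inbox (h' n)) ->
  zsum (fun n => f (h n)) = zsum f.
Proof.
move=> hK h'K hf; rewrite /zsum.
transitivity (\sum_(n <- map h (zrange (zbox N))) f n); first by rewrite big_map.
apply: big_reindex_supp; rewrite ?zrange_uniq //.
  by rewrite map_inj_uniq ?zrange_uniq //; apply: can_inj hK.
move=> i /hf/andP[h1 h2].
have -> : (i \in map h (zrange (zbox N))) = (h' i \in zrange (zbox N)).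
  by rewrite -[in LHS](h'K i) (mem_map (can_inj hK)).
by rewrite !mem_zrange; move: h1 h2; rewrite /inbox => -> ->.
Qed.

Lemma zsum2_reindex (h h' : int * int -> int * int) (F : int -> int -> R) :
  cancel h h' -> cancel h' h ->
  (forall m n, F m n != 0 -> [&& inbox m, inbox n, inbox (h' (m, n)).1
     & inbox (h' (m, n)).2]) ->
  zsum (fun m => zsum (fun n => F (h (m, n)).1 (h (m, n)).2)) =
  zsum (fun m => zsum (fun n => F m n)).
Proof.
move=> hK h'K hF; set s := zrange (zbox N).
have E (G : int * int -> R) : zsum (fun m => zsum (fun n => G (m, n))) =
    \sum_(p <- [seq (m, n) | m <- s, n <- s]) G p.
  by rewrite big_allpairs_dep.
rewrite (E (fun p => F (h p).1 (h p).2)) (E (fun p => F p.1 p.2)).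
set t := [seq (m, n) | m <- s, n <- s].
have ut : uniq t by apply: allpairs_uniq; rewrite ?zrange_uniq // => -[? ?] [? ?].
transitivity (\sum_(p <- map h t) F p.1 p.2); first by rewrite big_map.
apply: big_reindex_supp => //.
  by rewrite map_inj_uniq //; apply: can_inj hK.
move=> [m n] /= /hF/and4P[h1 h2 h3 h4].
have -> : ((m, n) \in map h t) = (h' (m, n) \in t).
  by rewrite -[in LHS](h'K (m, n)) (mem_map (can_inj hK)).
have memt p : (p \in t) = inbox p.1 && inbox p.2.
  rewrite /inbox -!mem_zrange -/s; apply/allpairsP/andP => [[[a b] /= [ha hb ->]] //|[ha hb]].
  by exists p; case: p ha hb.
by rewrite !memt /= h1 h2 h3 h4.
Qed.

Lemma zsum_split (d : nat) (f : int -> R) : (0 < d)%N ->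
  (forall n, f n != 0 -> inbox n) ->
  zsum f = \sum_(r < d) zsum (fun k => f (k * d%:Z + r%:Z)).
Proof.
move=> d0 hf; rewrite /zsum exchange_big /=.
transitivity (\sum_(p <- [seq (k * d%:Z + r%:Z) | k <- zrange (zbox N), r <- iota 0 d]) f p);
  last first.
  rewrite big_allpairs_dep; apply: eq_bigr => k _.
  by rewrite -(big_mkord xpredT (fun r => f (k * d%:Z + r%:Z))) /index_iota subn0.
apply: big_reindex_supp; rewrite ?zrange_uniq //.
  have := zrange_uniq (zbox N); move: (zrange (zbox N)) => z uz.
  apply: allpairs_uniq; rewrite ?iota_uniq // => -[k r] [k' r'] /=.
  move=> /allpairsPdep[a [b [_ + ha]]] /allpairsPdep[a' [b' [_ + ha']]].
  case: ha ha' => -> -> [-> ->].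
  rewrite !mem_iota => h1 h2 hE.
  have e1 : a = a' by nia.
  by rewrite e1 in hE *; congr (_, _); lia.
move=> n hn; rewrite mem_zrange; have := hf n hn; rewrite /inbox => hb; rewrite hb.
symmetry; apply/allpairsP; exists ((n %/ d%:Z)%Z, `|(n %% d%:Z)%Z|%N) => /=.
have hm := modz_ge0 n (_ : d%:Z != 0); have hl := ltz_pmod n (_ : 0 < d%:Z).
have dn := divz_eq n d%:Z.
split; [rewrite mem_zrange | rewrite mem_iota | ]; try lia; nia.
Qed.

(** The half-open box is invariant under [n -> -1 - n], the symmetry of the denominators
    [1 - q^(2n+1)]; this is why no support condition appears here or in [zsum_refl]. *)
Lemma zsum_antisym (f : int -> R) : (forall n, f (- 1 - n) = - f n) -> zsum f = 0.
Proof.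
move=> h; rewrite /zsum big_cat !big_map /= -big_split big1 // => i _.
have -> : Negz i = - 1 - Posz i by lia.
by rewrite (h (Posz i)); apply: addrN.
Qed.

Lemma zsum_refl (f : int -> R) : zsum f = zsum (fun n => f (- 1 - n)).
Proof.
have E g : zsum g = \sum_(i <- iota 0 (zbox N)) (g (Posz i) + g (Negz i)).
  by rewrite /zsum big_cat !big_map big_split.
rewrite !E; apply: eq_bigr => i _; rewrite addrC.
by congr (f _ + f _); lia.
Qed.

Lemma zsum_shift c (f : int -> R) : (forall n, f n != 0 -> inbox n && inbox (n - c)) ->
  zsum f = zsum (fun n => f (n + c)).
Proof.
move=> hf; rewrite -(@zsum_reindex (fun n => n + c) (fun n => n - c) f) //.
- by move=> n /=; lia.
- by move=> n /=; lia.
Qed.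

Lemma zsum_flip c (f : int -> R) : (forall n, f n != 0 -> inbox n && inbox (c - n)) ->
  zsum f = zsum (fun n => f (c - n)).
Proof.
move=> hf; rewrite -(@zsum_reindex (fun n => c - n) (fun n => c - n) f) //.
- by move=> n /=; lia.
- by move=> n /=; lia.
Qed.

Lemma zsum_antisym_at c (f : int -> R) :
  (forall n, f n != 0 -> inbox n && inbox (n - c)) ->
  (forall n, f (2 * c - 1 - n) = - f n) -> zsum f = 0.
Proof.
move=> hf h; rewrite (zsum_shift hf); apply: zsum_antisym => n.
by rewrite -h; congr f; lia.
Qed.

Lemma zsum2_conv c (F : int -> int -> R) :
  (forall m n, F m n != 0 -> [&& inbox m, inbox n & inbox (m + n + c)]) ->
  zsum (fun m => zsum (fun n => F m n)) = zsum (fun d => zsum (fun n => F (d - n - c) n)).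
Proof.
move=> hF; rewrite -(@zsum2_reindex (fun p => (p.1 - p.2 - c, p.2))
  (fun p => (p.1 + p.2 + c, p.2)) F) //.
- by move=> [m n] /=; congr (_, _); lia.
- by move=> [m n] /=; congr (_, _); lia.
- by move=> m n /hF /and3P[h1 h2 h3] /=; rewrite h1 h2 h3.
Qed.

Lemma zsum_split2 (f : int -> R) : (forall n, f n != 0 -> inbox n) ->
  zsum f = zsum (fun k => f (2 * k)) + zsum (fun k => f (2 * k + 1)).
Proof.
move=> hf; rewrite (@zsum_split 2) // !big_ord_recr big_ord0 /= add0r.
by congr (_ + _); apply: eq_zsum => k; congr f; lia.
Qed.

Lemma zsum_split3 (f : int -> R) : (forall n, f n != 0 -> inbox n) ->
  zsum f = zsum (fun k => f (3 * k)) + zsum (fun k => f (3 * k + 1)) + zsum (fun k => f (3 * k + 2)).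
Proof.
move=> hf; rewrite (@zsum_split 3) // !big_ord_recr big_ord0 /= add0r.
by congr (_ + _ + _); apply: eq_zsum => k; congr f; lia.
Qed.

End BilateralSums.

(** * Monomials and geometric series in a nilpotent variable *)

Section Fractions.
Variables (R : comNzRingType) (N : nat).
Implicit Types (q : R) (e m k : int).

(* Stands for [q^e]; only meaningful for [0 <= e], since [qz q (- e) = qz q e]. *)
Definition qz q e : R := q ^+ `|e|.
Definition sg (n : int) : R := (-1) ^+ `|n|.
Definition ginv q (k : nat) : R := \sum_(i < N) q ^+ (k * i).
(* [q^e / (1 - q^m)] for [m <> 0], expanded for negative [m] as [- q^(e-m) / (1 - q^(-m))];
   [valid e m] says that no negative power of [q] occurs in the expansion. *)
Definition qfrac q e m : R :=
  if 0 < m then qz q e * ginv q `|m| else - (qz q (e - m) * ginv q `|m|).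
Definition valid e m := if 0 < m then 0 <= e else m <= e.

Lemma sgD m n : sg (m + n) = sg m * sg n.
Proof.
rewrite /sg -exprD -signr_odd -[in RHS]signr_odd; congr (_ ^+ nat_of_bool _); lia.
Qed.

Lemma sgN n : sg (- n) = sg n.
Proof. by rewrite /sg abszN. Qed.

Lemma sg_even n : sg (2 * n) = 1.
Proof. by rewrite /sg -signr_odd (_ : odd _ = false) //; lia. Qed.

Lemma sg1 : sg 1 = -1.
Proof. by rewrite /sg expr1. Qed.

Lemma sgS n : sg (n + 1) = - sg n.
Proof. by rewrite sgD sg1 mulrN1. Qed.

Lemma sg_refl n : sg (- 1 - n) = - sg n.
Proof. by rewrite sgD !sgN sg1 mulN1r. Qed.

Lemma sg_sqr n : sg (n * n) = sg n.
Proof.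
rewrite /sg -signr_odd -[in RHS]signr_odd; congr (_ ^+ nat_of_bool _).
by rewrite abszM oddM andbb.
Qed.

Lemma qzD q e k : 0 <= e -> 0 <= k -> qz q (e + k) = qz q e * qz q k.
Proof. by move=> he hk; rewrite /qz -exprD; congr (_ ^+ _); lia. Qed.

Lemma qz_mul q e k s : e + k = s -> 0 <= e -> 0 <= k -> qz q e * qz q k = qz q s.
Proof. by move=> <- *; rewrite qzD. Qed.

Lemma qz_pow q (d : nat) e : qz (q ^+ d) e = qz q (d%:Z * e).
Proof. by rewrite /qz -exprM abszM. Qed.

Lemma qz_opp q e : qz (- q) e = sg e * qz q e.
Proof. by rewrite /qz exprNn. Qed.

Lemma qfrac_pow q (d : nat) e m : (0 < d)%N ->
  qfrac (q ^+ d) e m = qfrac q (d%:Z * e) (d%:Z * m).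
Proof.
move=> d0; rewrite /qfrac -mulrBr !qz_pow abszM /=.
have -> : (0 < d%:Z * m) = (0 < m) by rewrite pmulr_rgt0 //; lia.
have -> : ginv (q ^+ d) `|m| = ginv q (d * `|m|)%N.
  by apply: eq_bigr => i _; rewrite -exprM mulnA.
by [].
Qed.

Variable q : R.
Hypothesis qN : q ^+ N = 0.

Lemma expr_small j : (N <= j)%N -> q ^+ j = 0.
Proof. by move=> h; rewrite -(subnK h) exprD qN mulr0. Qed.

Lemma qz_small e : N%:Z <= e -> qz q e = 0.
Proof. by move=> h; apply: expr_small; lia. Qed.

Lemma qz_neq0 e : qz q e != 0 -> 0 <= e -> e < N%:Z.
Proof. by move=> h he; apply: contraNT h => h; rewrite qz_small //; lia. Qed.

Lemma ginvP (k : nat) : (0 < k)%N -> (1 - q ^+ k) * ginv q k = 1.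
Proof.
move=> k0; rewrite /ginv; under eq_bigr => i _ do rewrite exprM.
have := subrX1 (q ^+ k) N; rewrite -exprM (@expr_small (k * N)) ?leq_pmull // => h.
by rewrite -[LHS]opprK -mulNr opprB -h sub0r opprK.
Qed.

Lemma ginv_dvd (d k : nat) : (0 < k)%N -> (0 < d)%N ->
  ginv q k = (\sum_(i < d) q ^+ (k * i)) * ginv q (d * k).
Proof.
move=> k0 d0.
have h1 := ginvP k0; have h2 : (1 - q ^+ (d * k)) * ginv q (d * k) = 1.
  by apply: ginvP; rewrite muln_gt0 d0.
have h3 : 1 - q ^+ (d * k) = (1 - q ^+ k) * \sum_(i < d) q ^+ (k * i).
  under eq_bigr => i _ do rewrite exprM.
  by rewrite mulnC exprM -[LHS]opprB subrX1 -mulNr opprB.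
by rewrite -[LHS]mulr1 -h2 h3 mulrA mulrA [ginv q k * _]mulrC h1 mul1r.
Qed.

(** Splits off one monomial; the convention for [m < 0] is made so that this stays true there. It
    drives the recurrences of [appellT_shift] and [cubL]. *)
Lemma qfrac_step e m : 0 <= e -> m != 0 -> qfrac q e m = qz q e + qfrac q (e + m) m.
Proof.
move=> he m0; rewrite /qfrac; case: ifP => hm.
  have h : (1 - q ^+ `|m|%N) * ginv q `|m| = 1 by apply: ginvP; lia.
  rewrite qzD //; last lia.
  rewrite /qz; set g := ginv _ _ in h *; set y := q ^+ `|m|%N in h *.
  by rewrite -[X in _ = X + _]mulr1 -h; ring.
have h : (1 - q ^+ `|m|%N) * ginv q `|m| = 1 by apply: ginvP; lia.
rewrite addrK qzD //; last lia.
rewrite /qz abszN; set g := ginv _ _ in h *; set y := q ^+ `|m|%N in h *.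
by rewrite -[X in _ = X + _]mulr1 -h; ring.
Qed.

Lemma qfrac_mul k e m : valid e m -> 0 <= k -> qz q k * qfrac q e m = qfrac q (e + k) m.
Proof.
rewrite /valid /qfrac; case: ifP => hm he hk.
  by rewrite qzD //; ring.
have -> : e + k - m = (e - m) + k by lia.
by rewrite (@qzD q (e - m) k) //; [ring | lia].
Qed.

Lemma qz_qfrac k e m s : e + k = s -> valid e m -> 0 <= k ->
  qz q k * qfrac q e m = qfrac q s m.
Proof. by move=> <- *; rewrite qfrac_mul. Qed.

Lemma qfrac_neg e m : m != 0 -> qfrac q e (- m) = - qfrac q (e + m) m.
Proof.
move=> m0; rewrite /qfrac abszN opprK; case: ifP => hm; case: ifP => hm' //; try lia.
by rewrite addrK opprK.
Qed.

Lemma qfrac_small e m : (if 0 < m then N%:Z <= e else N%:Z <= e - m) -> qfrac q e m = 0.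
Proof. by rewrite /qfrac; case: ifP => hm he; rewrite qz_small // mul0r ?oppr0. Qed.

Lemma qfrac_neq0 e m : valid e m -> qfrac q e m != 0 ->
  if 0 < m then e < N%:Z else e - m < N%:Z.
Proof.
rewrite /valid => hv; have := @qfrac_small e m.
case: ifP hv => hm hv h h2; rewrite ltNge; apply/negP => h3; move: h2; rewrite h ?eqxx //.
Qed.

Lemma qfrac_split2 e m : m != 0 -> valid e m ->
  qfrac q e m = qfrac q e (2 * m) + qfrac q (e + m) (2 * m).
Proof.
move=> m0; rewrite /valid /qfrac abszM (_ : (0 < 2 * m) = (0 < m)); last lia.
case: ifP => hm hv; rewrite (@ginv_dvd 2 `|m|%N) ?big_ord_recr ?big_ord0 /=; try lia.
  by rewrite add0r muln0 expr0 muln1 (@qzD q e m) //; [rewrite /qz; ring | lia].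
rewrite add0r muln0 expr0 muln1.
rewrite (_ : e - m = (e - 2 * m) + m)%R; last lia.
rewrite (_ : e + m - 2 * m = e - m)%R; last lia.
rewrite (_ : e - 2 * m = (e - m) + (- m))%R; last lia.
rewrite subrK (@qzD q (e - m) (- m)); try lia.
by rewrite /qz abszN; ring.
Qed.

Lemma qfrac_split3 e m : m != 0 -> valid e m ->
  qfrac q e m = qfrac q e (3 * m) + qfrac q (e + m) (3 * m) + qfrac q (e + 2 * m) (3 * m).
Proof.
move=> m0; rewrite /valid /qfrac abszM (_ : (0 < 3 * m) = (0 < m)); last lia.
case: ifP => hm hv; rewrite (@ginv_dvd 3 `|m|%N) ?big_ord_recr ?big_ord0 /=; try lia.
  have h1 : 0 <= m by lia.
  have h2 : 0 <= 2 * m by lia.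
  rewrite add0r muln0 expr0 muln1 mulnC exprM (@qzD q e m) // (@qzD q e (2 * m)) //.
  by rewrite /qz abszM mulnC exprM; ring.
rewrite add0r muln0 expr0 muln1 mulnC exprM.
rewrite (_ : e + m - 3 * m = (e - m) + (- m))%R; last lia.
rewrite (_ : e - 3 * m = (e - m) + 2 * (- m))%R; last lia.
rewrite (_ : e + 2 * m - 3 * m = e - m)%R; last lia.
have h0 : 0 <= e - m by lia.
have h1 : 0 <= - m by lia.
have h2 : 0 <= 2 * (- m) by lia.
rewrite (@qzD q (e - m) (- m)) // (@qzD q (e - m) (2 * - m)) //.
by rewrite /qz !abszM !abszN mulnC exprM; ring.
Qed.

End Fractions.

(** Instances at chosen shifts replace nonlinear reasoning: once squares and products are atoms for
    [lia], linear combinations of these bounds control an index by its exponent. *)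
Lemma sqz (x : int) : x <= x * x /\ - x <= x * x.
Proof. nia. Qed.

Lemma neq0_mulr (R : comNzRingType) (a b : R) : a * b != 0 -> b != 0.
Proof. by apply: contraNneq => ->; rewrite mulr0. Qed.

(** * Theta functions and Appell sums *)

Section Theta.
Variables (R : comNzRingType) (N : nat).
Implicit Type q : R.

Definition phi q := zsum N (fun n => qz q (n * n)).
Definition psi q := zsum N (fun n => qz q (2 * (n * n) + n)).
Definition appellT q := zsum N (fun n => sg R n * qfrac N q (n * n + n) (2 * n + 1)).
Definition appellS q := zsum N (fun n => sg R n * qfrac N q (n * n + 2 * n) (2 * n + 1)).

Variable q : R.
Hypothesis qN : q ^+ N = 0.

Lemma nil_pow d : (0 < d)%N -> (q ^+ d) ^+ N = 0.
Proof. by move=> d0; rewrite -exprM (expr_small qN) ?leq_pmull. Qed.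

Lemma phi_opp : phi (- q) = zsum N (fun n => sg R n * qz q (n * n)).
Proof. by apply: eq_zsum => n; rewrite qz_opp sg_sqr. Qed.

(** Along the difference [d = m - n] the exponent becomes [d^2 + 4k^2 + 2k], with [k = n + d/2] for
    even [d] and [k = -n - (d+1)/2] for odd [d]. *)
Lemma psi_sqr : psi q ^+ 2 = phi q * psi (q ^+ 2).
Proof.
rewrite expr2 {1 2}/psi zsum_mul.
pose F (m n : int) := qz q (2 * (m * m) + m + (2 * (n * n) + n)).
transitivity (zsum N (fun m => zsum N (fun n => F m n))).
  apply: eq_zsum => m; apply: eq_zsum => n; have := sqz m; have := sqz n => hn hm.
  by apply: qz_mul => //; lia.
rewrite -(@zsum2_reindex _ _ (fun p => (p.2 + p.1, p.2)) (fun p => (p.1 - p.2, p.2)) F) /=;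
  first last.
- move=> m n /(qz_neq0 qN) h; have := sqz m; have := sqz n.
  by rewrite /inbox /zbox; lia.
- by move=> [m n] /=; congr (_, _); lia.
- by move=> [m n] /=; congr (_, _); lia.
rewrite /phi -zsumMr; apply: eq_zsum => d.
rewrite -zsumMl.
pose c := (d %/ 2)%Z.
pose f (n : int) := qz q (d * d + (4 * (n * n) + 2 * n)).
transitivity (zsum N f); last first.
  apply: eq_zsum => n; rewrite qz_pow; symmetry; have := sqz n; have := sqz d => h1 h2.
  by apply: qz_mul; lia.
have hf n : f n != 0 -> inbox N n && inbox N (n - c) && inbox N (- n - c - 1).
  move=> /(qz_neq0 qN) h; have := sqz n; have := sqz d.
  by rewrite /inbox /zbox; lia.
have [hd|hd] : d = 2 * c \/ d = 2 * c + 1 by lia.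
  rewrite -(@zsum_reindex _ _ (fun n => n + c) (fun n => n - c) f); first last.
  - by move=> n /hf /andP[/andP[-> ->]].
  - by move=> n /=; lia.
  - by move=> n /=; lia.
  by apply: eq_zsum => n; rewrite /F /f hd; congr qz; ring.
rewrite -(@zsum_reindex _ _ (fun n => - n - c - 1) (fun n => - n - c - 1) f); first last.
- by move=> n /hf /andP[/andP[-> _] ->].
- by move=> n /=; lia.
- by move=> n /=; lia.
by apply: eq_zsum => n; rewrite /F /f hd; congr qz; ring.
Qed.

(** Collect by [d = m + n]. For odd [d] the reflection [n -> d - n] changes the sign, so the sum
    vanishes; for [d = 2c], translating [n] by [c] gives [(c-n)^2 + (c+n)^2 = 2c^2 + 2n^2]. *)
Lemma phi_mul_opp : phi q * phi (- q) = phi (- q ^+ 2) ^+ 2.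
Proof.
rewrite phi_opp expr2 zsum_mul.
pose F (m n : int) := sg R n * qz q (m * m + n * n).
transitivity (zsum N (fun m => zsum N (fun n => F m n))).
  apply: eq_zsum => m; apply: eq_zsum => n; have := sqz m; have := sqz n => hn hm.
  by rewrite mulrCA; congr (_ * _); apply: qz_mul; lia.
rewrite (@zsum2_conv _ _ 0) /F; last first.
  move=> m n /neq0_mulr /(qz_neq0 qN) h.
  have := sqz m; have := sqz n; rewrite /inbox /zbox; lia.
pose G (d n : int) := sg R n * qz q ((d - n) * (d - n) + n * n).
transitivity (zsum N (fun d => zsum N (fun n => G d n))).
  by apply: eq_zsum => d; apply: eq_zsum => n; rewrite /G subr0.
have hG d n : G d n != 0 -> (d - n) * (d - n) + n * n < N%:Z.
  move=> /neq0_mulr /(qz_neq0 qN); apply; have := sqz n; have := sqz (d - n); lia.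
rewrite zsum_split2; last first.
  move=> d; have [h|h] := boolP (inbox N d) => //; rewrite /zsum big1 ?eqxx // => n _.
  apply/eqP; apply: contraNT h => /hG; have := sqz n; have := sqz (d - n).
  rewrite /inbox /zbox; lia.
rewrite [X in _ + X = _]big1 ?addr0; last first.
  move=> c _; apply: (@zsum_antisym_at _ _ (c + 1)) => [n /hG|n].
    have := sqz n; have := sqz (2 * c + 1 - n); rewrite /inbox /zbox; lia.
  rewrite /G; have -> : 2 * (c + 1) - 1 - n = 1 + 2 * c - n by lia.
  rewrite -mulNr; congr (_ * qz _ _); last by ring.
  by rewrite !sgD sgN sg_even sg1 mulr1 mulN1r.
rewrite /phi zsum_mul; apply: eq_zsum => c.
rewrite (@zsum_shift _ _ c); last first.
  move=> n /hG; have := sqz n; have := sqz (2 * c - n); rewrite /inbox /zbox; lia.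
apply: eq_zsum => n; rewrite !qz_opp !sg_sqr !qz_pow /G sgD.
rewrite mulrACA [sg R n * _]mulrC; congr (_ * _); symmetry.
by have := sqz n; have := sqz c => h1 h2; apply: qz_mul; lia.
Qed.

Lemma zsum_nn1 : zsum N (fun n => qz q (n * n + n)) = psi (q ^+ 2) *+ 2.
Proof.
have h (n : int) : qz q (n * n + n) != 0 -> n * n + n < N%:Z.
  by move/(qz_neq0 qN); apply; have := sqz n; lia.
rewrite zsum_split2; last first.
  move=> n /h; have := sqz (n - 1); have := sqz (n + 2); rewrite /inbox /zbox; lia.
rewrite mulr2n /psi; congr (_ + _).
  by apply: eq_zsum => n; rewrite qz_pow; congr qz; lia.
rewrite (@zsum_flip _ _ (-1)).
  by apply: eq_zsum => n; rewrite qz_pow; congr qz; lia.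
move=> n /h; have := sqz n; have := sqz (n + 2); rewrite /inbox /zbox; lia.
Qed.

(* Up to sign, [q^c] times [sum (-1)^n q^(n^2+n) / (1 - z q^(2n+1))] at [z = q^(2M)], with [n]
   replaced by [n - M]. *)
Definition appellT_shift M c :=
  zsum N (fun n => sg R n * qfrac N q ((n - M) * (n - M) + (n - M) + c) (2 * n + 1)).

Lemma odd_neq0 (n : int) : 2 * n + 1 != 0.
Proof. lia. Qed.

Lemma sg_qfrac_neq0 n e m : valid e m -> sg R n * qfrac N q e m != 0 ->
  if 0 < m then e < N%:Z else e - m < N%:Z.
Proof. by move=> hv /neq0_mulr; apply: qfrac_neq0. Qed.

(** The monomials split off by [qfrac_step] are antisymmetric under [n -> 2M + 1 - n] and add up to
    0. The bound on [M] keeps their support inside the box. *)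
Lemma appellT_shift_step M c : `|M| <= 20 * N.+1%:Z -> 0 <= c ->
  appellT_shift (M + 1) c = appellT_shift M (c + 2 * M + 1).
Proof.
move=> hM hc; rewrite /appellT_shift.
pose e n := (n - M - 1) * (n - M) + c.
have he n : 0 <= e n by rewrite /e; have := sqz (n - M); lia.
transitivity (zsum N (fun n => sg R n * qz q (e n) +
   sg R n * qfrac N q ((n - M) * (n - M) + (n - M) + (c + 2 * M + 1)) (2 * n + 1))).
  apply: eq_zsum => n; rewrite -mulrDr.
  have -> : (n - (M + 1)) * (n - (M + 1)) + (n - (M + 1)) + c = e n by rewrite /e; ring.
  have -> : (n - M) * (n - M) + (n - M) + (c + 2 * M + 1) = e n + (2 * n + 1).
    by rewrite /e; ring.
  by rewrite (qfrac_step qN) ?odd_neq0.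
rewrite zsumD [X in X + _ = _](_ : _ = 0) ?add0r //.
apply: (@zsum_antisym_at _ _ (M + 1)) => [n /neq0_mulr /(qz_neq0 qN)/(_ (he n))|n].
  have := sqz (n - M - 2); have := sqz (n - M + 1).
  by rewrite /e /inbox /zbox; lia.
rewrite (_ : 2 * (M + 1) - 1 - n = 1 + 2 * M - n); last by lia.
rewrite -mulNr; congr (_ * qz _ _); last by rewrite /e; ring.
by rewrite !sgD sgN sg_even sg1 mulr1 mulN1r.
Qed.

Lemma appellT_shift0 c : 0 <= c -> appellT_shift 0 c = qz q c * appellT q.
Proof.
move=> hc; rewrite /appellT_shift /appellT -zsumMl; apply: eq_zsum => n.
rewrite [RHS]mulrCA subr0; congr (_ * _).
by symmetry; apply: qz_qfrac => //; rewrite /valid; have := sqz n; case: ifP; lia.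
Qed.

Lemma appellT_shift_small M c : N%:Z <= c -> appellT_shift M c = 0.
Proof.
move=> hc; rewrite /appellT_shift /zsum big1 // => n _; rewrite (qfrac_small qN) ?mulr0 //.
by case: ifP => h; have := sqz (n - M); lia.
Qed.

(** Iterating the step down to [M = 0] adds up consecutive odd numbers, whence [M * M]. The last two
    hypotheses make the step applicable all along; the disjunction covers an [M] too large for the
    box, where both sides vanish because [N <= c]. *)
Lemma appellT_shift_eq M c : (`|M| <= 20 * N.+1%:Z) || (N%:Z <= c) -> (0 <= M -> 0 <= c) ->
  (M < 0 -> 2 * M + 1 <= c) -> appellT_shift M c = qz q (c + M * M) * appellT q.
Proof.
move=> h h1 h2; have [hM|hM] := boolP (`|M| <= 20 * N.+1%:Z); last first.
  have hc : N%:Z <= c by move: h; rewrite (negbTE hM).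
  by rewrite appellT_shift_small // (qz_small qN) ?mul0r //; nia.
clear h; case: (leP 0 M) => M0.
  have {h1 h2} h1 := h1 M0; case: M M0 hM => // k _.
  elim: k c h1 => [|k IH] c hc hk; first by rewrite appellT_shift0 // mul0r addr0.
  have -> : k.+1%:Z = k%:Z + 1 by lia.
  rewrite appellT_shift_step //; try lia.
  by rewrite IH; try lia; congr (qz _ _ * _); ring.
have {h1 h2} h1 := h2 M0; case: M M0 hM h1 => // k _.
have step M d : M < 0 -> `|M| <= 20 * N.+1%:Z -> 2 * M + 1 <= d ->
    appellT_shift M d = appellT_shift (M + 1) (d - 2 * M - 1).
  by move=> h1 h2 h3; rewrite appellT_shift_step; try lia; congr appellT_shift; lia.
elim: k c => [|k IH] c hk hc; rewrite step //; try lia.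
  by rewrite (_ : Negz 0 + 1 = 0) // appellT_shift0; [congr (qz _ _ * _); lia | lia].
rewrite (_ : Negz k.+1 + 1 = Negz k); last lia.
rewrite IH; try lia.
by congr (qz _ _ * _); rewrite !NegzE; lia.
Qed.

End Theta.

(** * The behaviour of [T] under [q -> q^2] *)

Section Theta2.
Variables (R : comNzRingType) (N : nat).
Variable q : R.
Hypothesis qN : q ^+ N = 0.
Let q2N : (q ^+ 2) ^+ N = 0 := nil_pow qN (isT : 0 < 2)%N.

Lemma zsum_eq0 (f : int -> R) : (forall n, f n = 0) -> zsum N f = 0.
Proof. by move=> h; rewrite /zsum big1. Qed.

(* Both sides equal the sum over [m, n] of [q^(m^2+m) (-1)^n q^(n^2+n)] times
   [1/(1-t) + (-1)^(m+n+1)/(1+t)], [t = q^(2n+1)]; the terms with [m + n + 1 = d] add up to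
   [2 q^(d^2) T(q^2)]. *)
Lemma appellT_step : phi N q * appellT N (q ^+ 2) *+ 2 = psi N (q ^+ 2) * appellT N q *+ 2.
Proof.
pose P (n : int) := qfrac N q (n * n + n) (2 * (2 * n + 1)).
pose P' (n : int) := qfrac N q (n * n + n + (2 * n + 1)) (2 * (2 * n + 1)).
have vP (n : int) : valid (n * n + n) (2 * n + 1).
  by rewrite /valid; have := sqz n; case: ifP; lia.
have vP2 (n : int) : valid (n * n + n) (2 * (2 * n + 1)).
  by rewrite /valid; have := sqz n; have := sqz (n + 2); case: ifP; lia.
have vP2' (n : int) : valid (n * n + n + (2 * n + 1)) (2 * (2 * n + 1)).
  by rewrite /valid; have := sqz n; case: ifP; lia.
pose G (m n : int) := qz q (m * m + m) *
  ((sg R n - sg R m) * P n + (sg R n + sg R m) * P' n).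
have nn1 (m : int) : 0 <= m * m + m by have := sqz m; lia.
transitivity (zsum N (fun m => zsum N (fun n => G m n))); last first.
  (* [P n + P' n] is the full Appell term; the part of [G] weighted by [sg R m] carries the
     antisymmetric sum of [(-1)^m q^(m^2+m)] as a factor and vanishes. *)
  transitivity (zsum N (fun m => qz q (m * m + m) * appellT N q) +
    zsum N (fun m => sg R m * qz q (m * m + m)) * zsum N (fun n => P' n - P n)).
    rewrite -zsumMr -zsumD; apply: eq_zsum => m; rewrite /appellT -!zsumMl -zsumD.
    apply: eq_zsum => n; rewrite (qfrac_split2 qN) ?odd_neq0 // /G -/(P n) -/(P' n); ring.
  have -> : zsum N (fun m => sg R m * qz q (m * m + m)) = 0.
    apply: zsum_antisym => n; rewrite sg_refl mulNr; congr (- (_ * qz _ _)); ring.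
  rewrite mul0r addr0.
  by rewrite zsumMr (zsum_nn1 qN) mulrnAl.
have hG m n : G m n != 0 -> m * m + m < N%:Z /\
    (if 0 < 2 * (2 * n + 1) then n * n + n < N%:Z else n * n + n - (2 * n + 1) < N%:Z).
  move=> h; split.
    by apply: (qz_neq0 qN) => //; apply: contraNneq h => h; rewrite /G h mul0r.
  have : P n != 0 \/ P' n != 0.
    case: (eqVneq (P n) 0) => [h1|]; last by left.
    case: (eqVneq (P' n) 0) => [h2|]; last by right.
    by move: h; rewrite /G h1 h2 !mulr0 addr0 mulr0 eqxx.
  case => /(qfrac_neq0 qN); [move/(_ (vP2 n)) | move/(_ (vP2' n))]; case: ifP; lia.
rewrite (@zsum2_conv _ _ 1); last first.
  move=> m n /hG[]; have := sqz (m - 1); have := sqz (m + 2).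
  have := sqz n; have := sqz (n + 2); have := sqz (n - 1); have := sqz (n - 5).
  by rewrite /inbox /zbox; case: ifP; lia.
rewrite -mulrnAr /phi -zsumMr; apply: eq_zsum => d.
rewrite mulrnAr -mulrnAl.
pose M := (d %/ 2)%Z.
have E n : G (d - n - 1) n = qz q ((d - n - 1) * (d - n - 1) + (d - n - 1)) * sg R n *
   ((1 + sg R d) * P n + (1 - sg R d) * P' n).
  have hs : sg R (d - n - 1) = - (sg R d * sg R n).
    have -> : d - n - 1 = d + (- 1 - n) by lia.
    by rewrite sgD sg_refl mulrN.
  by rewrite /G hs; ring.
transitivity (zsum N (fun n => qz q ((d - n - 1) * (d - n - 1) + (d - n - 1)) * sg R n *
   ((1 + sg R d) * P n + (1 - sg R d) * P' n))); last first.
  by apply: eq_zsum => n; rewrite E.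
have hM : (`|M| <= 20 * N.+1%:Z) || (N%:Z <= M * M) && (N%:Z <= M * M + 2 * M).
  by case: leP => //= h; have := sqz (M - 1); have := sqz (M + 2); lia.
(* The parity of [d] keeps only [P] or only [P']. Either one yields an [appellT_shift] in [q^2],
   with an extra factor [q] when [d] is odd. *)
have [hd|hd] : d = 2 * M \/ d = 2 * M + 1 by lia.
  have -> : sg R d = 1 by rewrite hd sg_even.
  transitivity (appellT_shift N (q ^+ 2) M (M * M) *+ 2).
    rewrite (appellT_shift_eq q2N); try by have := sqz M; lia.
    by rewrite qz_pow -mulrnAl; congr (qz _ _ *+ _ * _); rewrite hd; ring.
  rewrite -[in LHS]mulr_natl /appellT_shift -zsumMl; apply: eq_zsum => n.
  rewrite qfrac_pow // subrr mul0r addr0.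
  have <- : qz q ((d - n - 1) * (d - n - 1) + (d - n - 1)) * P n =
    qfrac N q (2%:Z * ((n - M) * (n - M) + (n - M) + M * M)) (2%:Z * (2 * n + 1)).
    by apply: qz_qfrac => //; rewrite hd; ring.
  ring.
have -> : sg R d = - 1 by rewrite hd sgS sg_even.
transitivity (q * appellT_shift N (q ^+ 2) M (M * M + 2 * M) *+ 2).
  rewrite (appellT_shift_eq q2N); try by have := sqz M; lia.
    have <- : qz q 1 * qz q (2%:Z * (M * M + 2 * M + M * M)) = qz q (d * d).
      by apply: qz_mul => //; [rewrite hd; ring | nia].
    by rewrite qz_pow [qz q 1]expr1 mulrA mulrnAl.
rewrite -[in LHS]mulr_natl /appellT_shift -!zsumMl; apply: eq_zsum => n.
rewrite qfrac_pow // subrr mul0r add0r.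
have vV : valid (2%:Z * ((n - M) * (n - M) + (n - M) + (M * M + 2 * M))) (2%:Z * (2 * n + 1)).
  have hM2 : M * M + 2 * M < 0 -> M = -1 by nia.
  rewrite /valid; have [h|h] := ltP (M * M + 2 * M) 0.
    by rewrite (hM2 h); have := sqz (n + 1); have := sqz (n + 2); case: ifP; lia.
  by have := sqz (n - M); case: ifP; lia.
have E3 : qz q ((d - n - 1) * (d - n - 1) + (d - n - 1)) * P' n =
    qz q 1 * qfrac N q (2%:Z * ((n - M) * (n - M) + (n - M) + (M * M + 2 * M))) (2%:Z * (2 * n + 1)).
    rewrite (@qz_qfrac _ _ _ 1 _ _ _ erefl) //.
    by apply: qz_qfrac => //; rewrite hd; ring.
move: E3; rewrite {2}/qz expr1 => E3.
rewrite [RHS](_ : _ = 2%:R * (sg R n * (qz q ((d - n - 1) * (d - n - 1) + (d - n - 1)) * P' n))).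
  by rewrite E3; ring.
ring.
Qed.

End Theta2.

Section Theta3.
Variables (R : comNzRingType) (N : nat).
Hypothesis two_reg : forall x y : R, x *+ 2 = y *+ 2 -> x = y.

Lemma mem0_zrange : 0 \in zrange (zbox N).
Proof. by rewrite mem_zrange /zbox; lia. Qed.

Lemma zsum_single (f : int -> R) : (forall n, n != 0 -> f n = 0) -> zsum N f = f 0.
Proof.
move=> hf; rewrite /zsum (bigD1_seq 0 mem0_zrange (zrange_uniq _)) /=.
by rewrite big1 ?addr0 // => n /hf.
Qed.

Lemma zsum_const1 (q : R) (g : int -> int) : g 0 = 0 -> (forall n, n != 0 -> 1 <= g n) ->
  exists x, zsum N (fun n => qz q (g n)) = 1 + q * x.
Proof.
move=> g0 hg; rewrite /zsum (bigD1_seq 0 mem0_zrange (zrange_uniq _)) /=.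
exists (\sum_(n <- zrange (zbox N) | n != 0) qz q (g n - 1)).
rewrite g0 mulr_sumr; congr (_ + _); apply: eq_bigr => n /hg h.
have := @qz_mul R q 1 (g n - 1) (g n); rewrite [qz q 1]expr1 => -> //; lia.
Qed.

Lemma nil_cancel (q x a b : R) : q ^+ N = 0 -> (1 + q * x) * a = (1 + q * x) * b -> a = b.
Proof.
move=> qN h; pose s := - (q * x).
have sN : s ^+ N = 0 by rewrite /s exprNn exprMn qN mul0r mulr0.
have hs : (\sum_(i < N) s ^+ i) * (1 + q * x) = 1.
  have := subrX1 s N; rewrite sN sub0r => e.
  by rewrite -[RHS]opprK e -mulNr opprB /s opprK mulrC.
by rewrite -[a]mul1r -[b]mul1r -hs -!mulrA h.
Qed.

Lemma psi1 (q : R) : exists x, psi N q = 1 + q * x.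
Proof. by apply: zsum_const1 => // n h; have := sqz n; nia. Qed.

Lemma nil_pos (q : R) : q ^+ N = 0 -> (0 < N)%N.
Proof. by case: N => //; rewrite expr0 => /eqP; rewrite oner_eq0. Qed.

Lemma appellT_at0 : (0 < N)%N -> appellT N (0 : R) = 1.
Proof.
move=> N0.
have z0 (e : int) : e != 0 -> qz (0 : R) e = 0 by move=> h; rewrite /qz expr0n; case: eqP => //; lia.
rewrite /appellT zsum_single => [|n h]; rewrite /qfrac.
  rewrite /= /ginv (bigD1 (Ordinal N0)) //= big1 ?addr0 => [|i hi].
    by rewrite /sg /qz !expr0 !mulr1.
  by rewrite expr0n; case: eqP => // e; case/negP: hi; apply/eqP/val_inj => /=; lia.
by case: ifP => hm; rewrite z0 ?mul0r ?oppr0 ?mulr0 //; nia.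
Qed.

Lemma psi_at0 : psi N (0 : R) = 1.
Proof. by have [x ->] := psi1 0; rewrite mul0r addr0. Qed.

(* By [appellT_step] and [psi_sqr] the quotient [T / psi^2] is invariant under [q -> q^2], and
   iterating this substitution sends a nilpotent [q] to [0]. *)
Lemma appellT_psi (q : R) : q ^+ N = 0 -> appellT N q = psi N q ^+ 2.
Proof.
move=> qN; have N0 := nil_pos qN.
have [k] : exists k, q ^+ (2 ^ k) = 0.
  by exists N; apply: (expr_small qN); apply/ltnW/ltn_expl.
elim: k q qN => [|k IH] q qN; first by rewrite expn0 expr1 => ->; rewrite appellT_at0 // psi_at0 expr1n.
rewrite expnS exprM => hk.
have q2N : (q ^+ 2) ^+ N = 0 by apply: nil_pow.
have [x hx] := psi1 (q ^+ 2).
apply: (@nil_cancel (q ^+ 2) x _ _ q2N); rewrite -hx.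
by rewrite -(two_reg (appellT_step qN)) IH // (psi_sqr qN); ring.
Qed.

Variable q : R.
Hypothesis qN : q ^+ N = 0.
Let q2N : (q ^+ 2) ^+ N = 0 := nil_pow qN (isT : 0 < 2)%N.

(** The second halves produced by [qfrac_split2]: the numerators have odd exponents and the
    denominators are in [q^2]. Only this parity matters later. *)
Definition phiS_odd := zsum N (fun M => zsum N (fun n => sg R n *
  qfrac N q ((2 * M - n) * (2 * M - n) + n * n + 2 * n + (2 * n + 1)) (2 * (2 * n + 1)))).

(** Collect by the sum [d] of the indices. The reflection [(d, n) -> (-1-d, -1-n)] exchanges even
    and odd [d], whence the factor 2. For [d = 2M], the first halves of the split terms form
    [q^(2(2M^2+M)) T(q^2)], and summing over [M] gives [psi(q^2) T(q^2) = psi(q^2)^3]. *)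
Lemma phi_appellS : phi N q * appellS N q = psi N (q ^+ 2) ^+ 3 *+ 2 + phiS_odd *+ 2.
Proof.
pose F (d n : int) := sg R n * qfrac N q ((d - n) * (d - n) + n * n + 2 * n) (2 * n + 1).
have vF (d n : int) : valid ((d - n) * (d - n) + n * n + 2 * n) (2 * n + 1).
  by rewrite /valid; have := sqz (d - n); have := sqz (n + 1); case: ifP; lia.
have hF d n : F d n != 0 -> (d - n) * (d - n) + n * n - 1 < N%:Z.
  by move/(sg_qfrac_neq0 qN (vF d n)); case: ifP; lia.
transitivity (zsum N (fun d => zsum N (fun n => F d n))).
  rewrite /phi /appellS zsum_mul.
  pose G (m n : int) := F (m + n) n.
  transitivity (zsum N (fun m => zsum N (fun n => G m n))).
    apply: eq_zsum => m; apply: eq_zsum => n; rewrite mulrCA; congr (_ * _).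
    apply: qz_qfrac; first by ring.
      by rewrite /valid; have := sqz (n + 1); case: ifP; lia.
    by have := sqz m; lia.
  rewrite (@zsum2_conv _ _ 0) => [|m n /hF]; last first.
    by have := sqz m; have := sqz n; have := sqz (n - 1);
      rewrite /inbox /zbox; lia.
  by apply: eq_zsum => d; apply: eq_zsum => n; rewrite /G subr0 subrK.
have refl d : zsum N (fun n => F (- 1 - d) n) = zsum N (fun n => F d n).
  rewrite zsum_refl; apply: eq_zsum => n; rewrite /F sg_refl.
  have -> : 2 * (-1 - n) + 1 = - (2 * n + 1) by lia.
  rewrite qfrac_neg ?odd_neq0 // mulrNN.
  have -> // : (- 1 - d - (- 1 - n)) * (- 1 - d - (- 1 - n)) + (- 1 - n) * (- 1 - n) +
    2 * (- 1 - n) + (2 * n + 1) = (d - n) * (d - n) + n * n + 2 * n by ring.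
have hd d : zsum N (fun n => F d n) != 0 -> inbox N d && inbox N (- 1 - d).
  apply: contraNT => h; apply/eqP; apply: zsum_eq0 => n; apply/eqP; apply: contraNT h.
  move/hF; have := sqz (d - n); have := sqz n; have := sqz (n - 1).
  by rewrite /inbox /zbox; lia.
rewrite zsum_split2 => [|d /hd /andP[] //].
rewrite [X in _ + X](_ : _ = zsum N (fun M => zsum N (fun n => F (2 * M) n))); last first.
  rewrite zsum_refl; apply: eq_zsum => M; rewrite -refl; apply: eq_zsum => n.
  by congr (F _ _); lia.
rewrite -mulr2n -mulrnDl; congr (_ *+ 2).
transitivity (zsum N (fun M => appellT_shift N (q ^+ 2) M (M * M + M)) + phiS_odd).
  rewrite /phiS_odd -zsumD; apply: eq_zsum => M; rewrite /appellT_shift -zsumD; apply: eq_zsum => n.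
  rewrite /F (qfrac_split2 qN) ?odd_neq0 // mulrDr qfrac_pow //.
  have -> // : (2 * M - n) * (2 * M - n) + n * n + 2 * n =
    2%:Z * ((n - M) * (n - M) + (n - M) + (M * M + M)) by ring.
have -> : psi N (q ^+ 2) ^+ 3 = psi N (q ^+ 2) * appellT N (q ^+ 2) by rewrite (appellT_psi q2N); ring.
congr (_ + _); rewrite /psi -zsumMr; apply: eq_zsum => M.
rewrite (appellT_shift_eq q2N); try by have := sqz M; lia.
  by congr (qz _ _ * _); ring.
have := sqz (M - 1); have := sqz (M + 2); case: leP => //=; lia.
Qed.
End Theta3.

(** * The recurrence for products of a theta series and a Lambert series *)

Section Cubic.
Variables (R : comNzRingType) (N : nat) (q : R).
Hypothesis qN : q ^+ N = 0.

(* [(-1)^K cubL t K] is [q^(t K)] times the coefficient of [x^K] in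
   [W(x) = f(x) A(x q^(-2), q^(-2)) - q^2 f(x q^(-2)) A(x, 1)], where
   [f(x) = sum (-1)^m q^(3m^2) x^m] and
   [A(y, z) = sum (-1)^n q^(3n^2+6n) y^n / (1 - z q^(6n+3))].  As [W(q^6 x)] is a monomial
   multiple of [W(x)], the coefficients satisfy a one-term recurrence; [t] selects the
   evaluation of [W] at [x = q^t]. *)
Definition expo1 (K n : int) := 3 * ((K - n) * (K - n)) + 3 * (n * n) + 4 * n.
Definition expo2 (K n : int) := 3 * ((K - n) * (K - n)) - 2 * (K - n) + 3 * (n * n) + 6 * n + 2.

(** The reflection under which the monomials split off from the two halves of [cubL] cancel. *)
Lemma expo_flip K n : expo2 K (K - 1 - n) = expo1 K n.
Proof. rewrite /expo1 /expo2; ring. Qed.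

Definition cubL t K : R := zsum N (fun n =>
  qfrac N q (expo1 K n + t * K) (6 * n + 1) - qfrac N q (expo2 K n + t * K) (6 * n + 3)).

Section Fixt.
Variable t : int.
Hypothesis ht : t = -2 \/ t = 0 \/ t = 2.

Lemma valid1 K n : valid (expo1 K n + t * K) (6 * n + 1).
Proof.
rewrite /valid /expo1; have := sqz (K - n); have := sqz n.
have [x ->] : exists x, K = x + n by exists (K - n); lia.
rewrite addrK; case: ifP; case: ht => [->|[->|->]]; lia.
Qed.

Lemma valid2 K n : valid (expo2 K n + t * K) (6 * n + 3).
Proof.
rewrite /valid /expo2; have := sqz (K - n); have := sqz n; have := sqz (K - n - 1).
have [x ->] : exists x, K = x + n by exists (K - n); lia.
rewrite addrK; case: ifP; case: ht => [->|[->|->]]; lia.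
Qed.

(** The four bounds [up1] to [down2] supply the nonnegative exponents that [qfrac_step] requires:
    the first two for passing from [K >= 0] to [K + 1], the last two for passing from [K <= 0] to
    [K - 1]. *)
Lemma up1 (K n : int) : 1 <= K -> 0 <= expo1 K n + t * K.
Proof.
have := sqz (K - n); have := sqz n; have := sqz (K - n - 1); have := sqz (n + 1).
rewrite /expo1; have [x ->] : exists x, K = x + n by exists (K - n); lia.
by rewrite addrK; case: ht => [->|[->|->]]; nia.
Qed.

Lemma up2 (K n : int) : 1 <= K -> 0 <= expo2 K n + t * K.
Proof.
have := sqz (K - n); have := sqz n; have := sqz (K - n - 1); have := sqz (n + 1); have := sqz (n + 2).
rewrite /expo2; have [x ->] : exists x, K = x + n by exists (K - n); lia.
by rewrite addrK; case: ht => [->|[->|->]]; nia.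
Qed.

Lemma down1 (K n : int) : K <= -1 -> 0 <= expo1 K n + t * K - (6 * n + 1).
Proof.
have := sqz (K - n); have := sqz n; have := sqz (K - n + 1); have := sqz (n - 1).
rewrite /expo1; have [x ->] : exists x, K = x + n by exists (K - n); lia.
by rewrite addrK; case: ht => [->|[->|->]]; nia.
Qed.

Lemma down2 (K n : int) : K <= -1 -> 0 <= expo2 K n + t * K - (6 * n + 3).
Proof.
have := sqz (K - n); have := sqz n; have := sqz (K - n - 1); have := sqz (n + 1).
rewrite /expo2; have [x ->] : exists x, K = x + n by exists (K - n); lia.
by rewrite addrK; case: ht => [->|[->|->]]; nia.
Qed.

Definition in_range (K : int) := `|K| <= 20 * N.+1%:Z.

Lemma left_cancel K c : in_range K -> (forall n, 0 <= expo1 K n + c) -> (forall n, 0 <= expo2 K n + c) ->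
  `|c| <= 200 * N.+1%:Z -> 
  zsum N (fun n => qz q (expo1 K n + c)) = zsum N (fun n => qz q (expo2 K n + c)).
Proof.
rewrite /in_range => hK h1 h2 hc.
rewrite [RHS](@zsum_flip _ _ (K - 1)); first by apply: eq_zsum => n; rewrite expo_flip.
move=> n /(qz_neq0 qN) /(_ (h2 n)) h; move: (sqz (K - n)) (sqz (n - 3)) (sqz (n + 3)) h.
by rewrite /expo2 /inbox /zbox; lia.
Qed.

(** Adding its denominator exponent to a numerator exponent at [K + 1] gives the one at [K] plus
    [6K + 4 + t], independently of [n] and equally in both halves. The split-off monomials cancel by
    [left_cancel]. *)
Lemma cubL_up (K : int) : 0 <= K -> in_range K -> in_range (K + 1) ->
  cubL t (K + 1) = qz q (6 * K + 4 + t) * cubL t K.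
Proof.
move=> K0 bK bK1; rewrite /cubL -zsumMl.
pose f n : R := qz q (expo1 (K + 1) n + t * (K + 1)) - qz q (expo2 (K + 1) n + t * (K + 1)).
have f0 : zsum N f = 0.
  rewrite /f zsumB left_cancel ?subrr //.
  - by move=> n; apply: up1; lia.
  - by move=> n; apply: up2; lia.
  - by move: bK; rewrite /in_range; case: ht => [->|[->|->]]; lia.
rewrite -[RHS]add0r -f0 -zsumD; apply: eq_zsum => n.
have k0 : 0 <= 6 * K + 4 + t by lia.
rewrite mulrBr !(@qfrac_mul _ N q) ?valid1 ?valid2 //.
rewrite (qfrac_step qN) ?up1 //; try lia.
rewrite (qfrac_step qN (e := expo2 _ _ + _)) ?up2 //; try lia.
have -> : expo1 (K + 1) n + t * (K + 1) + (6 * n + 1) = expo1 K n + t * K + (6 * K + 4 + t).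
  by rewrite /expo1; ring.
have -> : expo2 (K + 1) n + t * (K + 1) + (6 * n + 3) = expo2 K n + t * K + (6 * K + 4 + t).
  by rewrite /expo2; ring.
by rewrite /f; ring.
Qed.

Lemma cubL_down (K : int) : K <= 0 -> in_range K -> in_range (K - 1) ->
  cubL t (K - 1) = qz q (- 6 * K + 2 - t) * cubL t K.
Proof.
move=> K0 bK bK1; rewrite /cubL -zsumMl.
have [k kE] : exists k : int, k = - 6 * K + 2 - t by exists (- 6 * K + 2 - t).
rewrite -kE.
have hK : K - 1 <= -1 by lia.
have d1 (n : int) : 0 <= expo1 K n + (t * K + k).
  rewrite (_ : _ + _ = expo1 (K - 1) n + t * (K - 1) - (6 * n + 1)) ?down1 //.
  by rewrite kE /expo1; ring.
have d2 (n : int) : 0 <= expo2 K n + (t * K + k).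
  rewrite (_ : _ + _ = expo2 (K - 1) n + t * (K - 1) - (6 * n + 3)) ?down2 //.
  by rewrite kE /expo2; ring.
pose f n : R := qz q (expo1 K n + (t * K + k)) - qz q (expo2 K n + (t * K + k)).
have f0 : zsum N f = 0.
  rewrite /f zsumB left_cancel ?subrr //.
  by move: bK; rewrite /in_range kE; case: ht => [->|[->|->]]; lia.
rewrite -[LHS]add0r -f0 -zsumD; apply: eq_zsum => n.
have k0 : 0 <= k by rewrite kE; lia.
rewrite [in RHS]mulrBr !(@qfrac_mul _ N q) ?valid1 ?valid2 //.
rewrite -!(addrA _ (t * K)).
rewrite [in RHS](qfrac_step qN) //; try lia.
rewrite [in RHS](qfrac_step qN (e := expo2 _ _ + _)) //; try lia.
have -> : expo1 K n + (t * K + k) + (6 * n + 1) = expo1 (K - 1) n + t * (K - 1).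
  by rewrite /expo1 kE; ring.
have -> : expo2 K n + (t * K + k) + (6 * n + 3) = expo2 (K - 1) n + t * (K - 1).
  by rewrite /expo2 kE; ring.
by rewrite /f; ring.
Qed.

Lemma cubL_big (K : int) : ~~ in_range K -> cubL t K = 0.
Proof.
rewrite /in_range => hK; apply: zsum_eq0 => n.
have := valid1 K n; have := valid2 K n.
rewrite !(qfrac_small qN) ?subrr //.
  move: hK (sqz (K - n - 3)) (sqz (K - n + 3)) (sqz (n - 3)) (sqz (n + 3)).
  by rewrite /expo2; case: ifP; case: ht => [->|[->|->]]; lia.
move: hK (sqz (K - n - 3)) (sqz (K - n + 3)) (sqz (n - 3)) (sqz (n + 3)).
by rewrite /expo1; case: ifP; case: ht => [->|[->|->]]; lia.
Qed.

(** For [K >= 0], [3K^2 + K + tK] is the sum of [6k + 4 + t] over [k < K]; negative [K] descends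
    from 0 with the same closed form. Beyond [in_range] both sides are 0. *)
Lemma cubL_eq (K : int) : cubL t K = qz q (3 * (K * K) + K + t * K) * cubL t 0.
Proof.
have [hK|hK] := boolP (in_range K); last first.
  rewrite cubL_big // (qz_small qN) ?mul0r //.
  move: hK (sqz (K - 3)) (sqz (K + 3)); rewrite /in_range.
  by case: ht => [->|[->|->]]; lia.
have base : qz q (3 * (0 * 0) + 0 + t * 0) = 1 :> R by rewrite !mulr0 /qz expr0.
case: K hK => k; elim: k => [|k IH] hK.
- by rewrite base mul1r.
- have -> : k.+1%:Z = k%:Z + 1 by lia.
  move: hK; rewrite /in_range => hK.
  rewrite cubL_up ?IH /in_range ?mulrA; try lia.
  congr (_ * _); apply: qz_mul; [ring | lia | ].
  by have := sqz k; case: ht => [->|[->|->]]; lia.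
- have b0 : in_range 0 by rewrite /in_range; lia.
  have b1 : in_range (0 - 1) by rewrite /in_range; lia.
  rewrite (_ : Negz 0 = 0 - 1) // cubL_down //.
  by congr (qz _ _ * _); rewrite mulrN1; lia.
have -> : Negz k.+1 = Negz k - 1 by lia.
move: hK; rewrite /in_range => hK.
rewrite cubL_down ?IH /in_range ?mulrA; try lia.
congr (_ * _); apply: qz_mul; [ring | lia | ].
by have := sqz (Negz k); case: ht => [->|[->|->]]; lia.
Qed.

End Fixt.
End Cubic.

(** * Two identities between Lambert series *)

Section Cubic2.
Variables (R : comNzRingType) (N : nat) (q : R).
Hypothesis qN : q ^+ N = 0.

(** These are the pieces of the trisection of [S], with [q^3] renamed [q]; likewise [phiW] comes
    from [(3n+1)^2 = 1 + 3(3n^2+2n)] in [phi(-q)]. *)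
Definition lambert (j c k : int) : R :=
  zsum N (fun s => sg R s * qfrac N q (3 * (s * s) + j * s + k) (6 * s + c)).
Definition phiW := zsum N (fun n => sg R n * qz q (3 * (n * n) + 2 * n)).

Lemma phi_cube : phi N (- q ^+ 3) = zsum N (fun n => sg R n * qz q (3 * (n * n))).
Proof. by rewrite phi_opp; apply: eq_zsum => n; rewrite qz_pow. Qed.

Lemma phiWN : phiW = zsum N (fun n => sg R n * qz q (3 * (n * n) - 2 * n)).
Proof.
rewrite /phiW (@zsum_flip _ _ 0); last first.
  move=> n /neq0_mulr /(qz_neq0 qN) h; have := sqz n; rewrite /inbox /zbox; lia.
by apply: eq_zsum => n; rewrite sub0r sgN; congr (_ * qz _ _); ring.
Qed.

Lemma zsum_qfrac_conv (b f c : int -> int) :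
  (forall m, 0 <= b m) -> (forall n, valid (f n) (c n)) ->
  (forall m n, b m + (if 0 < c n then f n else f n - c n) < N%:Z ->
     [&& inbox N m, inbox N n & inbox N (m + n)]) ->
  zsum N (fun m => sg R m * qz q (b m)) * zsum N (fun n => sg R n * qfrac N q (f n) (c n)) =
  zsum N (fun K => sg R K * zsum N (fun n => qfrac N q (b (K - n) + f n) (c n))).
Proof.
move=> hb hv hs; rewrite zsum_mul.
pose F m n := sg R (m + n) * qfrac N q (b m + f n) (c n).
have vF m n : valid (b m + f n) (c n).
  by have := hv n; have := hb m; rewrite /valid; case: ifP; lia.
transitivity (zsum N (fun m => zsum N (fun n => F m n))).
  apply: eq_zsum => m; apply: eq_zsum => n.
  by rewrite mulrACA -sgD qfrac_mul // /F (addrC (b m)).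
rewrite (@zsum2_conv _ _ 0).
  by apply: eq_zsum => K; rewrite -zsumMl; apply: eq_zsum => n; rewrite /F subr0 subrK.
move=> m n /neq0_mulr /(qfrac_neq0 qN (vF m n)) h; rewrite addr0; apply: hs.
by move: h; case: ifP; lia.
Qed.

Let t0 : (0 : int) = -2 \/ (0 : int) = 0 \/ (0 : int) = 2. Proof. by right; left. Qed.
Let tm : (-2 : int) = -2 \/ (-2 : int) = 0 \/ (-2 : int) = 2. Proof. by left. Qed.
Let tp : (2 : int) = -2 \/ (2 : int) = 0 \/ (2 : int) = 2. Proof. by right; right. Qed.

(** All evaluations are multiples of one constant, whose value therefore never has to be
    computed. *)
Lemma cubL0_indep t : cubL N q t 0 = cubL N q 0 0.
Proof. by apply: eq_zsum => n; rewrite !mulr0. Qed.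

Lemma sqz_strong (x : int) :
  [/\ x <= x * x, - x <= x * x, 5 * x <= x * x + 6 & - 5 * x <= x * x + 6].
Proof.
have := sqz (x - 3); have := sqz (x - 2); have := sqz (x + 2); have := sqz (x + 3).
by split; lia.
Qed.

Ltac supp := let m := fresh "m" in let n := fresh "n" in
  move=> m n; move: (sqz_strong m) (sqz_strong n) => [? ? ? ?] [? ? ? ?];
  rewrite /inbox /zbox; case: ifP; lia.

Ltac valid_tac := let n := fresh "n" in move=> n; rewrite /valid;
  have := sqz n; have := sqz (n + 1); case: ifP; lia.

(* The two sides differ by a multiple of [sum_K (-1)^K q^(3K^2+3K) = 0]. *)
Lemma lambert_identity1 : phiW * lambert 6 1 0 = phi N (- q ^+ 3) * lambert 8 3 2.
Proof.
apply/eqP; rewrite -subr_eq0; apply/eqP.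
transitivity (zsum N (fun K => sg R K * cubL N q 2 K)).
  rewrite phi_cube /phiW /lambert !zsum_qfrac_conv //; try valid_tac; try supp.
  - rewrite -zsumB; apply: eq_zsum => K; rewrite -mulrBr -zsumB; congr (_ * _).
    apply: eq_zsum => n; congr (qfrac _ _ _ _ - qfrac _ _ _ _); rewrite /expo1 /expo2; ring.
  - by move=> n; have := sqz n; lia.
  - by move=> n; have := sqz n; lia.
transitivity (zsum N (fun K => sg R K * qz q (3 * (K * K) + K + 2 * K)) * cubL N q 0 0).
  by rewrite -zsumMr; apply: eq_zsum => K; rewrite (cubL_eq qN tp) cubL0_indep mulrA.
rewrite zsum_antisym ?mul0r // => K; rewrite sg_refl mulNr.
by congr (- (_ * qz _ _)); ring.
Qed.

(* Expanding both differences along [cubL], the evaluations at [t = 0] and [t = -2] agree because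
   [3K^2 + K] and [3K^2 - K] are exchanged by [K -> -K]. *)
Lemma lambert_identity2 : phi N (- q ^+ 3) * lambert 4 1 0 =
  phiW * (lambert 2 1 0 + lambert 4 3 1 + lambert 6 3 2).
Proof.
apply/eqP; rewrite mulrDr -subr_eq -subr_eq0; apply/eqP.
have -> : phi N (- q ^+ 3) * lambert 4 1 0 - phiW * lambert 6 3 2 =
    zsum N (fun K => sg R K * cubL N q 0 K).
  rewrite phi_cube phiWN /lambert !zsum_qfrac_conv //; try valid_tac; try supp.
  - rewrite -zsumB; apply: eq_zsum => K; rewrite -mulrBr -zsumB; congr (_ * _).
    apply: eq_zsum => n; congr (qfrac _ _ _ _ - qfrac _ _ _ _); rewrite /expo1 /expo2; ring.
  - by move=> n; have := sqz n; lia.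
  - by move=> n; have := sqz n; lia.
have -> : phiW * (lambert 2 1 0 + lambert 4 3 1) = zsum N (fun K => sg R K * cubL N q (-2) K).
  (* The reindexing [n -> 1 - n] produces the exponents demanded by [expo2] at [t = -2]; its sign
     turns the sum of Lambert series into the difference inside [cubL]. *)
  have wE : phiW = - zsum N (fun n => sg R n * qz q (3 * (n * n) - 4 * n + 1)).
    rewrite phiWN (@zsum_flip _ _ 1); last first.
      move=> n /neq0_mulr /(qz_neq0 qN) h; have := sqz n; rewrite /inbox /zbox; lia.
    rewrite -zsumN; apply: eq_zsum => n; rewrite sgD sg1 sgN mulN1r mulNr.
    by congr (- (_ * qz _ _)); ring.
  rewrite mulrDr {1}phiWN wE mulNr /lambert !zsum_qfrac_conv //; try valid_tac; try supp.
  - rewrite -zsumB; apply: eq_zsum => K; rewrite -mulrBr -zsumB; congr (_ * _).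
    apply: eq_zsum => n; congr (qfrac _ _ _ _ - qfrac _ _ _ _); rewrite /expo1 /expo2; ring.
  - by move=> n; have := sqz n; have := sqz (n - 1); lia.
  - by move=> n; have := sqz n; lia.
transitivity ((zsum N (fun K => sg R K * qz q (3 * (K * K) + K)) -
  zsum N (fun K => sg R K * qz q (3 * (K * K) - K))) * cubL N q 0 0).
  rewrite -!zsumB -zsumMr; apply: eq_zsum => K.
  rewrite (cubL_eq qN t0) (cubL_eq qN tm) !cubL0_indep mul0r addr0.
  have -> : 3 * (K * K) + K + -2 * K = 3 * (K * K) - K by ring.
  by rewrite mulrBl !mulrA.
rewrite [X in X - _](@zsum_flip _ _ 0); last first.
  move=> n /neq0_mulr /(qz_neq0 qN) h; have := sqz n; rewrite /inbox /zbox; lia.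
rewrite -zsumB zsum_eq0 ?mul0r // => n; rewrite sub0r sgN.
by apply/eqP; rewrite subr_eq0; apply/eqP; congr (_ * qz _ _); ring.
Qed.

Lemma lambert_refl : lambert 8 3 2 = lambert 4 3 0.
Proof.
rewrite /lambert zsum_refl; apply: eq_zsum => n; rewrite sg_refl.
have -> : 6 * (-1 - n) + 3 = - (6 * n + 3) by ring.
rewrite qfrac_neg; last lia.
by rewrite mulrNN; congr (_ * qfrac _ _ _ _); ring.
Qed.

End Cubic2.

(** * Dissections modulo 3 *)

Section Product.
Variables (R : comNzRingType) (N : nat) (q : R).
Hypothesis qN : q ^+ N = 0.

(** The indices 0 and 1 modulo 3 in [psi], with [q^3] renamed [q]: [18s^2 + 3s] and
    [18s^2 + 15s + 3] are divided by 3. *)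
Definition psiA := zsum N (fun s => qz q (6 * (s * s) + s)) +
  zsum N (fun s => qz q (6 * (s * s) + 5 * s + 1)).
Definition theta9 := zsum N (fun n => sg R n * qz q (9 * (n * n) - 3 * n)).

Section Conv3.
Variable E : int -> int -> int.
Hypothesis E0 : forall x n, 0 <= E x n.
Hypothesis Eb : forall x n, E x n < N%:Z -> `|x| <= N%:Z + 10 /\ `|n| <= N%:Z + 10.

(* The terms of [sum (-1)^n q^(E x n)] with [x + n = 3 rho + i], translated by [n -> n + 2 rho]. *)
Definition piece i rho := zsum N (fun n => sg R n * qz q (E (rho + i - n) (n + 2 * rho))).

Lemma piece_supp (i rho n : int) : 0 <= i <= 2 ->
  sg R n * qz q (E (rho + i - n) (n + 2 * rho)) != 0 ->
  `|rho| <= N%:Z + 10 /\ `|n| <= 3 * N%:Z + 30.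
Proof. by move=> hi /neq0_mulr /(qz_neq0 qN) /(_ (E0 _ _)) /Eb[]; lia. Qed.

Lemma zsum_conv3 : zsum N (fun x => zsum N (fun n => sg R n * qz q (E x n))) =
  zsum N (piece 0) + zsum N (piece 1) + zsum N (piece 2).
Proof.
rewrite (@zsum2_conv _ _ 0) => [|x n /neq0_mulr /(qz_neq0 qN) /(_ (E0 _ _)) /Eb []]; last first.
  rewrite /inbox /zbox; lia.
rewrite zsum_split3 => [|k]; last first.
  apply: contraNT => h; apply/eqP/zsum_eq0 => n; apply/eqP; apply: contraNT h.
  move=> /neq0_mulr /(qz_neq0 qN) /(_ (E0 _ _)) /Eb [].
  rewrite /inbox /zbox; lia.
have sh i rho : 0 <= i <= 2 ->
    zsum N (fun n => sg R n * qz q (E (3 * rho + i - n - 0) n)) = piece i rho.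
  move=> hi; rewrite (@zsum_shift _ _ (2 * rho)).
    apply: eq_zsum => n; rewrite sgD sg_even mulr1; congr (_ * qz _ (E _ _)); ring.
  move=> n /neq0_mulr /(qz_neq0 qN) /(_ (E0 _ _)) /Eb []; rewrite /inbox /zbox; lia.
congr (_ + _ + _); apply: eq_zsum => rho; rewrite -sh //.
by apply: eq_zsum => n; rewrite ?addr0.
Qed.

(** The translation by [2 rho] kills the cross term, [6(rho-n)^2 + 3(n+2rho)^2 = 18 rho^2 + 9 n^2],
    so the double sum becomes a product. The substitution [h] brings the linear part to that of
    [theta9]. *)
Lemma piece_factor (s : R) (u : int -> int) (i : int) (h h' : int -> int) :
  0 <= i <= 2 -> cancel h h' -> cancel h' h ->
  (forall n, `|h' n| <= `|n| + 5) ->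
  (forall rho, 0 <= u rho) ->
  (forall n, sg R (h n) = s * sg R n) ->
  (forall rho n, E (rho + i - h n) (h n + 2 * rho) = 9 * (n * n) - 3 * n + u rho) ->
  zsum N (piece i) = s * (theta9 * zsum N (fun rho => qz q (u rho))).
Proof.
move=> hi hK h'K hb hu hs hE.
rewrite /theta9 -zsumMl -zsumMl; apply: eq_zsum => rho; rewrite /piece.
rewrite -(@zsum_reindex _ _ h h') //.
  rewrite -zsumMr -zsumMl; apply: eq_zsum => n; rewrite hs -!mulrA; congr (_ * (_ * _)).
  by rewrite hE; symmetry; apply: qz_mul => //; have := sqz n; lia.
by move=> n /(piece_supp hi) []; have := hb n; rewrite /inbox /zbox; lia.
Qed.

Lemma piece_zero (i c : int) : 0 <= i <= 2 -> `|c| <= 5 ->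
  (forall rho n, E (rho + i - (2 * c - 1 - n)) (2 * c - 1 - n + 2 * rho) =
     E (rho + i - n) (n + 2 * rho)) ->
  zsum N (piece i) = 0.
Proof.
move=> hi hc hE; apply: zsum_eq0 => rho; apply: (@zsum_antisym_at _ _ c) => n.
  by move=> /(piece_supp hi) []; rewrite /inbox /zbox; lia.
by rewrite hE (_ : 2 * c - 1 - n = -1 - n + 2 * c) ?sgD ?sg_even ?mulr1 -?sgD ?sg_refl ?mulNr //; lia.
Qed.

End Conv3.

Lemma sg_1B (n : int) : sg R (1 - n) = -1 * sg R n.
Proof. by rewrite sgD sg1 sgN. Qed.

Lemma sg_2B (n : int) : sg R (2 - n) = 1 * sg R n.
Proof. by rewrite sgD sgN (sg_even R 1). Qed.

Lemma sg_D1 (n : int) : sg R (n + 1) = -1 * sg R n.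
Proof. by rewrite sgS mulN1r. Qed.

(** [E0] belongs to [psi(q^3) phi(-q^3)]; [E1] and [E2] to the two halves of [psiA * phiW], the
    second after [x -> -1 - x]. *)
Let E0 (x n : int) := 6 * (x * x) + 3 * x + 3 * (n * n).
Let E1 (x n : int) := 6 * (x * x) + x + (3 * (n * n) - 2 * n).
Let E2 (x n : int) := 6 * (x * x) + 7 * x + 2 + (3 * (n * n) - 2 * n).

Ltac ineqs := let x := fresh "x" in let n := fresh "n" in
  move=> x n; have := sqz x; have := sqz (x + 1); have := sqz n; rewrite /E0 /E1 /E2; lia.
Ltac bnds := let x := fresh "x" in let n := fresh "n" in
  move=> x n; move: (sqz_strong x) (sqz_strong n) => [? ? ? ?] [? ? ? ?]; rewrite /E0 /E1 /E2; lia.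

Lemma conv_E0 : zsum N (fun x => zsum N (fun n => sg R n * qz q (E0 x n))) =
  theta9 * (zsum N (fun r => qz q (18 * (r * r) + 3 * r)) -
        zsum N (fun r => qz q (18 * (r * r) + 15 * r + 3))).
Proof.
have Ep : forall x n, 0 <= E0 x n by ineqs.
have Eb x n : E0 x n < N%:Z -> `|x| <= N%:Z + 10 /\ `|n| <= N%:Z + 10 by move: x n; bnds.
rewrite zsum_conv3 //.
rewrite (@piece_factor _ Ep Eb 1 (fun r => 18 * (r * r) + 3 * r) 0 id id) //; try lia.
- rewrite (@piece_factor _ Ep Eb (-1) (fun r => 18 * (r * r) + 15 * r + 3) 1
    (fun n => 1 - n) (fun n => 1 - n)) //; try lia.
  + rewrite (@piece_zero _ Ep Eb 2 2) //; last by move=> r n; rewrite /E0; ring.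
    by ring.
  + by move=> n /=; lia.
  + by move=> n /=; lia.
  + by move=> r; have := sqz r; lia.
  + exact: sg_1B.
  + by move=> r n; rewrite /E0; ring.
- by move=> r; have := sqz r; lia.
- by move=> n; rewrite mul1r.
- by move=> r n; rewrite /E0; ring.
Qed.

Lemma conv_E1 : zsum N (fun x => zsum N (fun n => sg R n * qz q (E1 x n))) =
  theta9 * (zsum N (fun r => qz q (18 * (r * r) - 3 * r)) -
        zsum N (fun r => qz q (18 * (r * r) + 9 * r + 1))).
Proof.
have Ep : forall x n, 0 <= E1 x n by ineqs.
have Eb x n : E1 x n < N%:Z -> `|x| <= N%:Z + 10 /\ `|n| <= N%:Z + 10 by move: x n; bnds.
rewrite zsum_conv3 //.
rewrite (@piece_factor _ Ep Eb 1 (fun r => 18 * (r * r) - 3 * r) 0 id id) //; try lia.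
- rewrite (@piece_factor _ Ep Eb (-1) (fun r => 18 * (r * r) + 9 * r + 1) 1
    (fun n => 1 - n) (fun n => 1 - n)) //; try lia.
  + rewrite (@piece_zero _ Ep Eb 2 2) //; last by move=> r n; rewrite /E1; ring.
    by ring.
  + by move=> n /=; lia.
  + by move=> n /=; lia.
  + by move=> r; have := sqz r; lia.
  + exact: sg_1B.
  + by move=> r n; rewrite /E1; ring.
- by move=> r; have := sqz r; lia.
- by move=> n; rewrite mul1r.
- by move=> r n; rewrite /E1; ring.
Qed.

Lemma conv_E2 : zsum N (fun x => zsum N (fun n => sg R n * qz q (E2 x n))) =
  theta9 * (zsum N (fun r => qz q (18 * (r * r) + 27 * r + 10)) -
        zsum N (fun r => qz q (18 * (r * r) + 15 * r + 3))).
Proof.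
have Ep : forall x n, 0 <= E2 x n by ineqs.
have Eb x n : E2 x n < N%:Z -> `|x| <= N%:Z + 10 /\ `|n| <= N%:Z + 10 by move: x n; bnds.
rewrite zsum_conv3 //.
rewrite (@piece_zero _ Ep Eb 0 1) //; last by move=> r n; rewrite /E2; ring.
rewrite (@piece_factor _ Ep Eb (-1) (fun r => 18 * (r * r) + 15 * r + 3) 1
    (fun n => n + 1) (fun n => n - 1)) //; try lia.
- rewrite (@piece_factor _ Ep Eb 1 (fun r => 18 * (r * r) + 27 * r + 10) 2
    (fun n => 2 - n) (fun n => 2 - n)) //; try lia.
  + by ring.
  + by move=> n /=; lia.
  + by move=> n /=; lia.
  + by move=> r; have := sqz r; have := sqz (r + 1); lia.
  + exact: sg_2B.
  + by move=> r n; rewrite /E2; ring.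
- by move=> n /=; lia.
- by move=> n /=; lia.
- by move=> r; have := sqz r; lia.
- exact: sg_D1.
- by move=> r n; rewrite /E2; ring.
Qed.

(** All three double sums are [theta9] times a difference of two theta series. In the sum for [E1]
    and [E2], the series with [18r^2+27r+10] and [18r^2+9r+1] agree by reflection and cancel,
    leaving the value for [E0]. *)
Lemma psiA_phiW : psiA * phiW N q = phi N (- q ^+ 3) * psi N (q ^+ 3).
Proof.
have -> : phi N (- q ^+ 3) * psi N (q ^+ 3) =
    zsum N (fun x => zsum N (fun n => sg R n * qz q (E0 x n))).
  rewrite phi_cube mulrC zsum_mul; apply: eq_zsum => x; apply: eq_zsum => n.
  rewrite mulrCA qz_pow; congr (_ * _); have := sqz x; have := sqz n => ? ?.
  by apply: qz_mul; [rewrite /E0; ring | lia | lia].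
have -> : psiA * phiW N q = zsum N (fun x => zsum N (fun n => sg R n * qz q (E1 x n))) +
    zsum N (fun x => zsum N (fun n => sg R n * qz q (E2 x n))).
  rewrite /psiA mulrDl; congr (_ + _).
    rewrite (phiWN qN) zsum_mul; apply: eq_zsum => x; apply: eq_zsum => n.
    rewrite mulrCA; congr (_ * _); have := sqz x; have := sqz n => ? ?.
    by apply: qz_mul => //; lia.
  rewrite [X in X * _]zsum_refl (phiWN qN) zsum_mul; apply: eq_zsum => x; apply: eq_zsum => n.
  rewrite mulrCA; congr (_ * _); have := sqz x; have := sqz (x + 1); have := sqz n => ? ? ?.
  by apply: qz_mul; [rewrite /E2; ring | lia | lia].
rewrite conv_E0 conv_E1 conv_E2.
have -> : zsum N (fun r => qz q (18 * (r * r) + 27 * r + 10)) =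
    zsum N (fun r => qz q (18 * (r * r) + 9 * r + 1)).
  by rewrite zsum_refl; apply: eq_zsum => r; congr qz; ring.
have -> : zsum N (fun r => qz q (18 * (r * r) - 3 * r)) =
    zsum N (fun r => qz q (18 * (r * r) + 3 * r)).
  rewrite (@zsum_flip _ _ 0); first by apply: eq_zsum => r; congr qz; ring.
  move=> r /(qz_neq0 qN) h; move: (sqz_strong r) h => [? ? ? ?]; rewrite /inbox /zbox; lia.
ring.
Qed.

End Product.

Section Dissection.
Variables (R : comNzRingType) (N : nat) (q : R).
Hypothesis qN : q ^+ N = 0.
Lemma qz1 : qz q 1 = q. Proof. exact: expr1. Qed.

Lemma qz_mulq e s : 1 + e = s -> 0 <= e -> q * qz q e = qz q s.
Proof. by move=> h he; rewrite -{1}qz1; apply: qz_mul. Qed.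

Lemma qfrac_mulq e m s : e + 1 = s -> valid e m -> q * qfrac N q e m = qfrac N q s m.
Proof. by move=> h he; rewrite -{1}qz1; apply: qz_qfrac. Qed.

Lemma sg_3n (n : int) : sg R (3 * n) = sg R n.
Proof. by rewrite (_ : 3 * n = 2 * n + n) ?sgD ?sg_even ?mul1r //; ring. Qed.

Lemma psi_dissect : psi N q = psiA N (q ^+ 3) + q * psi N ((q ^+ 3) ^+ 3).
Proof.
rewrite {1}/psi zsum_split3; last first.
  by move=> n /(qz_neq0 qN) h; move: (sqz_strong n) h => [? ? ? ?]; rewrite /inbox /zbox; lia.
rewrite [X in _ + X]zsum_refl /psiA /psi -zsumMl; congr (_ + _ + _); apply: eq_zsum => n.
- by rewrite qz_pow; congr qz; ring.
- by rewrite qz_pow; congr qz; ring.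
rewrite -exprM qz_pow; symmetry.
by have := sqz n => ?; apply: qz_mulq; [ring | lia].
Qed.

Lemma phi_dissect : phi N (- q) = phi N (- (q ^+ 3) ^+ 3) - q * phiW N (q ^+ 3) *+ 2.
Proof.
rewrite phi_opp zsum_split3; last first.
  move=> n /neq0_mulr /(qz_neq0 qN) h; have := sqz n; rewrite /inbox /zbox; lia.
rewrite [X in _ + X]zsum_refl phi_cube mulr2n opprD addrA.
congr (_ + _ + _).
- by apply: eq_zsum => n; rewrite sg_3n qz_pow; congr (_ * qz _ _); ring.
- rewrite /phiW -zsumMl -zsumN; apply: eq_zsum => n; rewrite sgS sg_3n qz_pow mulrCA mulNr.
  congr (- (_ * _)); symmetry.
  by have := sqz n => ?; apply: qz_mulq; [ring | lia].
- rewrite /phiW -zsumMl -zsumN; apply: eq_zsum => n; rewrite qz_pow mulrCA.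
  rewrite (_ : 3 * (-1 - n) + 2 = - 1 - 3 * n); last lia.
  rewrite sg_refl sg_3n mulNr; congr (- (_ * _)); symmetry.
  by have := sqz n => ?; apply: qz_mulq; [ring | lia].
Qed.

(** The terms are invariant under [n -> -1 - n], which exchanges the indices 0 and 2 modulo 3
    (whence the factors 2). [qfrac_split3] puts every denominator in [q^3]; for [n = 3s + 1] the
    numerators are then in [q^3] as well. *)
Lemma appellS_dissect : appellS N q =
  lambert N (q ^+ 3) 2 1 0 *+ 2 -
  (lambert N (q ^+ 3) 4 3 1 + lambert N (q ^+ 3) 6 3 2 + lambert N (q ^+ 3) 8 3 3) +
  q * (lambert N (q ^+ 3) 4 1 0 *+ 2) + q ^+ 2 * (lambert N (q ^+ 3) 6 1 0 *+ 2).
Proof.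
pose F (n : int) := sg R n * qfrac N q (n * n + 2 * n) (2 * n + 1).
have vF (n : int) : valid (n * n + 2 * n) (2 * n + 1).
  by rewrite /valid; have := sqz (n + 1); case: ifP; lia.
have Fr n : F (- 1 - n) = F n.
  rewrite /F sg_refl (_ : 2 * (-1 - n) + 1 = - (2 * n + 1)); last by ring.
  rewrite qfrac_neg ?odd_neq0 // mulrNN.
  by have -> : (-1 - n) * (-1 - n) + 2 * (-1 - n) + (2 * n + 1) = n * n + 2 * n by ring.
rewrite /appellS -/(zsum N F) zsum_split3; last first.
  move=> n /neq0_mulr /(qfrac_neq0 qN (vF n)); have := sqz n; have := sqz (n - 2).
  by rewrite /inbox /zbox; case: ifP; lia.
have e0 : zsum N (fun k => F (3 * k)) =
    lambert N (q ^+ 3) 2 1 0 + q * lambert N (q ^+ 3) 4 1 0 + q ^+ 2 * lambert N (q ^+ 3) 6 1 0.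
  rewrite /lambert -!zsumMl -!zsumD; apply: eq_zsum => s.
  rewrite /F (qfrac_split3 qN) //; last lia.
  rewrite !qfrac_pow // sg_3n.
  have v1 : valid (3%:Z * (3 * (s * s) + 4 * s + 0)) (3%:Z * (6 * s + 1)).
    by rewrite /valid; have := sqz s; case: ifP; lia.
  have v2 : valid (3%:Z * (3 * (s * s) + 6 * s + 0)) (3%:Z * (6 * s + 1)).
    by rewrite /valid; have := sqz s; case: ifP; lia.
  have E1 := @qfrac_mul _ N q 1 _ _ v1 isT; rewrite qz1 in E1.
  have E2 := @qfrac_mul _ N q 2 _ _ v2 isT; rewrite -/(q ^+ 2) in E2.
  rewrite [q * _]mulrCA [q ^+ 2 * _]mulrCA E1.
  rewrite (_ : q ^+ 2 = qz q 2) // E2 -!mulrDr; congr (_ * (_ + _ + _));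
    congr (qfrac _ _ _ _); ring.
have expo1 : zsum N (fun k => F (3 * k + 1)) =
    - (lambert N (q ^+ 3) 4 3 1 + lambert N (q ^+ 3) 6 3 2 + lambert N (q ^+ 3) 8 3 3).
  rewrite /lambert -!zsumD -zsumN; apply: eq_zsum => s.
  rewrite /F (qfrac_split3 qN) //; last lia.
  rewrite !qfrac_pow // sgS sg_3n -!mulrDr -mulNr; congr (_ * (_ + _ + _));
    congr (qfrac _ _ _ _); ring.
have expo2 : zsum N (fun k => F (3 * k + 2)) = zsum N (fun k => F (3 * k)).
  rewrite zsum_refl; apply: eq_zsum => k; rewrite -Fr; congr F; ring.
by rewrite expo2 expo1 e0; ring.
Qed.

Lemma lambert_mul (j c k : int) : (forall s, valid (3 * (s * s) + j * s + k) (6 * s + c)) ->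
  q * lambert N q j c k = lambert N q j c (k + 1).
Proof.
move=> hv; rewrite /lambert -zsumMl; apply: eq_zsum => s; rewrite mulrCA.
by congr (_ * _); apply: qfrac_mulq; rewrite ?addrA.
Qed.

End Dissection.

(** * From the definition of [B] to Appell sums *)

Section Bailey.
Variables (R : comNzRingType) (N : nat) (q : R).
Hypothesis qN : q ^+ N = 0.

Local Notation g := (ginv N q).
(** In order: [1/(q^2;q^2)_k], [(-q^2;q^2)_k], [1/(q;q^2)_k], [(-q;q^2)_k]. *)
Definition ipoch k := \prod_(i < k) g (2 * i.+1).
Definition mpoch k := \prod_(i < k) (1 + q ^+ (2 * i.+1)).
Definition iodd k := \prod_(i < k) g (2 * i + 1).
Definition modd k := \prod_(i < k) (1 + q ^+ (2 * i + 1)).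
Definition Bsum := \sum_(n < N) q ^+ n * modd n * iodd n.+1.

Lemma gP k : (0 < k)%N -> (1 - q ^+ k) * g k = 1.
Proof. exact: ginvP. Qed.

Lemma ipochS k : ipoch k = (1 - q ^+ (2 * k.+1)) * ipoch k.+1.
Proof.
rewrite /ipoch big_ord_recr /= mulrCA.
by rewrite gP ?mulr1.
Qed.

(* [sum_n (-q;q^2)_n z^n / (z;q^2)_(n+1)] at [z = q^(2m+1)]. *)
Definition B_shift m := \sum_(n < N)
  q ^+ ((2 * m + 1) * n) * modd n * \prod_(i < n.+1) g (2 * (m + i) + 1).

(** With [z = q^(2m+1)], one factor [1 - z] removes the first denominator of each term. The other
    telescopes to [1] plus the sum of [t (n+1) - z t n], where [(1 + q^(2n+1)) - (1 - z q^(2n+2)) =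
    q^(2n+1) (1 + z q)]. *)
Lemma B_shift_step m : (1 - q ^+ (2 * m + 1)) ^+ 2 * B_shift m =
  1 + q ^+ (2 * m + 2) * (1 + q ^+ (2 * m + 2)) * B_shift m.+1.
Proof.
set c := q ^+ (2 * m + 1).
pose t n := c ^+ n * modd n * \prod_(i < n) g (2 * (m + i).+1 + 1).
have E1 : (1 - c) * B_shift m = \sum_(n < N) t n.
  rewrite /B_shift mulr_sumr; apply: eq_bigr => n _.
  rewrite big_ord_recl /= addn0 /t /c -exprM.
  rewrite (eq_bigr (fun i : 'I_n => g (2 * (m + i).+1 + 1))); last first.
    by move=> i _; congr g; rewrite /= /bump /=; lia.
  set P := \prod_(i < n) _.
  have h := gP (ltn0Sn (2 * m)); rewrite -addn1 in h.
  transitivity ((1 - q ^+ (2 * m + 1)) * g (2 * m + 1) * (q ^+ ((2 * m + 1) * n) * modd n * P)).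
    by ring.
  by rewrite h mul1r.
have tN : t N = 0 by rewrite /t /c exprAC qN expr0n addn1 /= !mul0r.
have E2 : (1 - c) * (\sum_(n < N) t n) = 1 + \sum_(n < N) (t n.+1 - c * t n).
  have t0 : t 0%N = 1 by rewrite /t expr0 /modd !big_ord0 !mul1r.
  have : \sum_(n < N) (t n.+1 - t n) = - 1.
    by rewrite -(big_mkord xpredT (fun n => t n.+1 - t n)) telescope_sumr // tN t0 sub0r.
  move=> h; transitivity (- (\sum_(n < N) (t n.+1 - t n)) + \sum_(n < N) (t n.+1 - c * t n));
    last by rewrite h opprK.
  rewrite -sumrN -big_split /= mulr_sumr.
  by apply: eq_bigr => n _; ring.
rewrite expr2 -mulrA E1 E2; congr (_ + _).
rewrite /B_shift mulr_sumr; apply: eq_bigr => n _.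
rewrite /t /modd !big_ord_recr /= -/(modd n).
set P := \prod_(i < n) _.
rewrite addSn; set G := g _.
have h : P = (1 - q ^+ (2 * (m + n).+1 + 1)) * G * P by rewrite gP ?mul1r // addn1.
rewrite {2}h.
have -> : q ^+ ((2 * m.+1 + 1) * n) = c ^+ n * q ^+ (2 * n).
  by rewrite /c -exprM -exprD; congr (_ ^+ _); lia.
have -> : q ^+ (2 * (m + n).+1 + 1) = c * q ^+ (2 * n) * q ^+ 2.
  by rewrite /c -!exprD; congr (_ ^+ _); lia.
have -> : q ^+ (2 * m + 2) = c * q.
  by rewrite /c -exprSr; congr (_ ^+ _); lia.
have -> : q ^+ (2 * n + 1) = q ^+ (2 * n) * q.
  by rewrite -exprSr; congr (_ ^+ _); lia.
rewrite exprS; ring.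
Qed.

Lemma ioddS k : iodd k.+1 = iodd k * g (2 * k + 1).
Proof. by rewrite /iodd big_ord_recr. Qed.

Lemma Bsum_iter K : Bsum = \sum_(k < K) q ^+ (k * k.+1) * mpoch k * iodd k.+1 ^+ 2 +
  q ^+ (K * K.+1) * mpoch K * iodd K ^+ 2 * B_shift K.
Proof.
elim: K => [|K ->].
  rewrite big_ord0 add0r mul0n expr0 /mpoch /iodd !big_ord0 expr1n !mul1r.
  by apply: eq_bigr => n _; rewrite mul1n.
rewrite big_ord_recr /= -addrA; congr (_ + _).
have -> : B_shift K = g (2 * K + 1) ^+ 2 *
    (1 + q ^+ (2 * K + 2) * (1 + q ^+ (2 * K + 2)) * B_shift K.+1).
  by rewrite -B_shift_step mulrA -exprMn [g _ * _]mulrC gP ?addn1 // expr1n mul1r.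
rewrite ioddS /mpoch big_ord_recr /= -/(mpoch K).
have -> : q ^+ (K.+1 * K.+2) = q ^+ (K * K.+1) * q ^+ (2 * K + 2).
  by rewrite -exprD; congr (_ ^+ _); lia.
by rewrite (_ : 2 * K.+1 = 2 * K + 2)%N; [ring | lia].
Qed.

(** After [N] steps the remainder carries [q^(N(N+1)) = 0]. The new form is the left side of
    [bailey] with [beta n = 1/(q;q^2)_(n+1)^2]. *)
Lemma Bsum_eq : Bsum = \sum_(k < N) q ^+ (k * k.+1) * mpoch k * iodd k.+1 ^+ 2.
Proof.
by rewrite (Bsum_iter N) (@expr_small _ N q qN (N * N.+1)) ?leq_pmulr // !mul0r addr0.
Qed.

Definition baileyC_term j n := mpoch n * q ^+ (n * n.+1) * ipoch (n - j) * ipoch (n + j.+1).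
Definition baileyC j := \sum_(j <= n < N) baileyC_term j n.

(* Telescoping certificate for [baileyC (j+1) = q^(2(j+1)) baileyC j]. *)
Lemma baileyC_partial j r :
  \sum_(j.+1 <= n < j.+1 + r) baileyC_term j.+1 n -
    q ^+ (2 * j.+1) * \sum_(j <= n < j.+1 + r) baileyC_term j n =
  - ((1 - q ^+ (2 * j.+1)) * mpoch (j.+1 + r) * q ^+ ((j.+1 + r) * (j.+1 + r).+1) *
     ipoch r * ipoch (j.+1 + r + j.+1)).
Proof.
set s := q ^+ (2 * j.+1).
elim: r => [|r IH].
  rewrite addn0 big_geq // big_nat1 sub0r; congr (- _).
  rewrite /baileyC_term subnn.
  have -> : ipoch (j + j.+1) = (1 - s * s) * ipoch (j.+1 + j.+1).
    rewrite ipochS addSn; congr ((1 - _) * _); rewrite /s -exprD; congr (_ ^+ _); lia.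
  have -> : mpoch j.+1 = mpoch j * (1 + s) by rewrite /mpoch big_ord_recr.
  have -> : q ^+ (j.+1 * j.+2) = q ^+ (j * j.+1) * s.
    by rewrite /s -exprD; congr (_ ^+ _); lia.
  by ring.
rewrite addnS; have [n En] : exists n, (j.+1 + r)%N = n by exists (j.+1 + r)%N.
rewrite En in IH *; rewrite !big_nat_recr /=; try lia.
set S1 := \sum_(j.+1 <= i < n) _ in IH *; set S0 := \sum_(j <= i < n) _ in IH *.
transitivity ((S1 - s * S0) + (baileyC_term j.+1 n - s * baileyC_term j n)); first by ring.
rewrite IH /baileyC_term.
have -> : (n - j.+1 = r)%N by lia.
have -> : (n - j = r.+1)%N by lia.
have -> : mpoch n.+1 = mpoch n * (1 + q ^+ (2 * n.+1)) by rewrite /mpoch big_ord_recr.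
rewrite (ipochS r) (ipochS (n + j.+1)).
have -> : (n + j.+2 = (n + j.+1).+1)%N by lia.
have -> : (n.+1 + j.+1 = (n + j.+1).+1)%N by lia.
set X := ipoch r.+1; set Y := ipoch (n + j.+1).+1.
set m := q ^+ (2 * r.+1).
have -> : q ^+ (2 * n.+1) = s * m by rewrite -exprD; congr (_ ^+ _); lia.
have -> : q ^+ (2 * (n + j.+1).+1) = s * s * m by rewrite -!exprD; congr (_ ^+ _); lia.
have -> : q ^+ (n.+1 * n.+2) = q ^+ (n * n.+1) * (s * m).
  by rewrite -!exprD; congr (_ ^+ _); lia.
by ring.
Qed.

Lemma baileyC_step j : (j < N)%N -> baileyC j.+1 = q ^+ (2 * j.+1) * baileyC j.
Proof.
move=> hj; have := baileyC_partial j (N - j.+1); rewrite subnKC //.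
rewrite (@expr_small _ N q qN (N * N.+1)) ?leq_pmulr // mulr0 !mul0r oppr0.
by move/eqP; rewrite subr_eq0 => /eqP.
Qed.

Lemma baileyC_eq j : (j <= N)%N -> baileyC j = q ^+ (j * j.+1) * baileyC 0.
Proof.
elim: j => [|j IH] hj; first by rewrite mul0n expr0 mul1r.
rewrite baileyC_step // IH 1?ltnW // mulrA -exprD; congr (_ ^+ _ * _); lia.
Qed.

(** Bailey's lemma in base [q^2] with [a = q^2], up to normalization: after exchanging the sums the
    inner one is [baileyC j]. The constant [baileyC 0] is found afterwards from the unit pair. *)
Lemma bailey (alpha beta : nat -> R) :
  (forall n, beta n = \sum_(j < n.+1) alpha j * ipoch (n - j) * ipoch (n + j.+1)) ->
  \sum_(n < N) mpoch n * q ^+ (n * n.+1) * beta n =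
  baileyC 0 * \sum_(j < N) q ^+ (j * j.+1) * alpha j.
Proof.
move=> h; rewrite mulr_sumr.
transitivity (\sum_(0 <= n < N) \sum_(0 <= j < N | (j <= n)%N) alpha j * baileyC_term j n).
  rewrite big_mkord; apply: eq_bigr => n _; rewrite h mulr_sumr.
  rewrite -(big_mkord xpredT (fun j => mpoch n * q ^+ (n * n.+1) *
    (alpha j * ipoch (n - j) * ipoch (n + j.+1)))).
  rewrite (big_nat_widen _ _ N) //=.
  by apply: eq_big => [j|j _]; [rewrite ltnS | rewrite /baileyC_term; ring].
rewrite (exchange_big_dep_nat xpredT) //=.
rewrite -(big_mkord xpredT (fun j => baileyC 0 * (q ^+ (j * j.+1) * alpha j))).
rewrite [RHS]big_nat_cond [LHS]big_nat_cond; apply: eq_bigr => j; rewrite andbT => /andP[_ hj].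
rewrite mulrA [baileyC 0 * _]mulrC -baileyC_eq 1?ltnW // mulrC /baileyC mulr_sumr.
by rewrite (big_nat_widenl j 0) //; apply: eq_bigl => n; rewrite andbT.
Qed.

(** For [n > 0] the partial sums times [1 - q^(2n)] have a closed form, which the last term cancels.
    The truncated [j.-1] at [j = 0] is harmless, being multiplied by [j]. *)
Lemma unit_pair n : \sum_(j < n.+1)
  ((-1) ^+ j * q ^+ (j * j.-1) * (1 - q ^+ (4 * j + 2))) * ipoch (n - j) * ipoch (n + j.+1)
   = (n == 0%N)%:R.
Proof.
case: n => [|n].
  rewrite big_ord1 /= muln0 expr0 !mul1r subnn /ipoch big_ord0 mulr1 big_ord1.
  by rewrite muln1 (gP (isT : 0 < 2)%N).
set m := n.+1.
pose f j := ((-1) ^+ j * q ^+ (j * j.-1) * (1 - q ^+ (4 * j + 2))) * ipoch (m - j) * ipoch (m + j.+1).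
have P j : (j <= n)%N -> (1 - q ^+ (2 * m)) * \sum_(i < j.+1) f i =
    (-1) ^+ j * q ^+ (j * j.+1) * (1 - q ^+ (2 * j.+1)) * ipoch (n - j) * ipoch (m + j.+1).
  elim: j => [|j IH] hj.
    rewrite big_ord1 /f subn0 muln0 mul0n !expr0 !mul1r subn0 (ipochS n) /m.
    by rewrite /=; ring.
  rewrite big_ord_recr /= mulrDr IH; last lia.
  have [r hr] : exists r, n = (j + r.+1)%N by exists (n - j.+1)%N; lia.
  rewrite /f (_ : m - j.+1 = r.+1)%N; last by rewrite /m; lia.
  rewrite (_ : n - j = r.+1)%N; last lia.
  rewrite (_ : n - j.+1 = r)%N; last lia.
  rewrite (ipochS r) (ipochS (m + j.+1)) (_ : m + j.+2 = (m + j.+1).+1)%N; last lia.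
  set X := ipoch r.+1; set Y := ipoch (m + j.+1).+1.
  set s := q ^+ (2 * j.+1); set k := q ^+ (2 * r.+1).
  have -> : q ^+ (2 * m) = s * k by rewrite -exprD; congr (_ ^+ _); rewrite /m; lia.
  have -> : q ^+ (2 * (m + j.+1).+1) = s * s * k * q ^+ 2.
    by rewrite -!exprD; congr (_ ^+ _); rewrite /m; lia.
  have -> : q ^+ (4 * j.+1 + 2) = s * s * q ^+ 2 by rewrite -!exprD; congr (_ ^+ _); lia.
  have -> : q ^+ (2 * j.+2) = s * q ^+ 2 by rewrite -!exprD; congr (_ ^+ _); lia.
  have -> : q ^+ (j.+1 * j.+2) = q ^+ (j * j.+1) * s by rewrite -!exprD; congr (_ ^+ _); lia.
  rewrite /= (_ : j.+1 * j = j * j.+1)%N; last lia.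
  by rewrite [(-1) ^+ j.+1]exprS; ring.
rewrite big_ord_recr /= -/m.
have h0 : (1 - q ^+ (2 * m)) * (\sum_(i < m) f i + f m) = 0.
  rewrite mulrDr P // subnn /f subnn (ipochS (m + n.+1)).
  rewrite (_ : m + m.+1 = (m + n.+1).+1)%N; last by rewrite /m; lia.
  rewrite (_ : 2 * (m + n.+1).+1 = 4 * m + 2)%N; last by rewrite /m; lia.
  rewrite /= (_ : m * n = n * n.+1)%N; last by rewrite /m; lia.
  rewrite (_ : (-1) ^+ m = - (-1) ^+ n :> R); last by rewrite /m exprS mulN1r.
  by rewrite -/m; ring.
suff: \sum_(i < m) f i + f m = 0 by [].
by rewrite -[LHS]mul1r -(gP (isT : 0 < 2 * m)%N) [_ * g _]mulrC -mulrA h0 mulr0.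
Qed.

(* Induction on [n], from [(1-X)^2 = (X/Y)(1-Y)^2 + (1-X/Y)(1-XY)] with [X = q^(2n+1)] and
   [Y = q^(2j+1)]; the first summand contributes a multiple of [unit_pair]. *)
Lemma odd_pair n : iodd n.+1 ^+ 2 = \sum_(j < n.+1)
  ((-1) ^+ j * q ^+ (j * j.+1) * (1 + q ^+ (2 * j + 1)) * g (2 * j + 1)) *
    ipoch (n - j) * ipoch (n + j.+1).
Proof.
elim: n => [|n IH].
  rewrite big_ord1 /= muln0 !expr0 !mul1r subnn /ipoch /iodd big_ord0 mulr1 !big_ord1.
  rewrite muln1 muln0 add0n !expr1.
  have h : (1 - q) * g 1 = 1 := gP (isT : 0 < 1)%N.
  have h2 : (1 - q ^+ 2) * g 2 = 1 by apply: gP.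
  set a := g 1 in h *; set b2 := g 2 in h2 *.
  transitivity ((1 - q ^+ 2) * b2 * a ^+ 2); first by rewrite h2 mul1r.
  transitivity ((1 - q) * a * ((1 + q) * a * b2)); first by ring.
  by rewrite h; ring.
set m := n.+1; set X := q ^+ (2 * m + 1).
have hg : (1 - X) * g (2 * m + 1) = 1 by apply: gP; rewrite addn1.
pose F k j := ((-1) ^+ j * q ^+ (j * j.+1) * (1 + q ^+ (2 * j + 1)) * g (2 * j + 1)) *
    ipoch (k - j) * ipoch (k + j.+1).
pose U j := ((-1) ^+ j * q ^+ (j * j.-1) * (1 - q ^+ (4 * j + 2))) *
   ipoch (m - j) * ipoch (m + j.+1).
have key : (1 - X) ^+ 2 * \sum_(j < m.+1) F m j = \sum_(j < m) F n j.
  transitivity (\sum_(j < m) F n j + q ^+ (2 * m) * \sum_(j < m.+1) U j); last first.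
    by rewrite unit_pair /= mulr0 addr0.
  have step j c : (j <= m)%N -> (1 - X) ^+ 2 = q ^+ (2 * (m - j)) * (1 - q ^+ (2 * j + 1)) ^+ 2 + c ->
     (1 - X) ^+ 2 * F m j = c * F m j + q ^+ (2 * m) * U j.
    move=> hj ->; rewrite mulrDl addrC; congr (_ + _).
    have hy : (1 - q ^+ (2 * j + 1)) * g (2 * j + 1) = 1 by apply: gP; rewrite addn1.
    rewrite /F /U; set Y := q ^+ (2 * j + 1) in hy *; set G := g _ in hy *.
    have -> : q ^+ (4 * j + 2) = Y * Y by rewrite -exprD; congr (_ ^+ _); lia.
    have e : q ^+ (2 * (m - j)) * q ^+ (j * j.+1) = q ^+ (2 * m) * q ^+ (j * j.-1).
      by rewrite -!exprD; congr (_ ^+ _); case: j hj {hy Y G} => [|j] /=; lia.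
    transitivity ((q ^+ (2 * (m - j)) * q ^+ (j * j.+1)) * ((1 - Y) * G) *
      ((-1) ^+ j * (1 + Y) * (1 - Y) * ipoch (m - j) * ipoch (m + j.+1))).
      by ring.
    by rewrite e hy; ring.
  pose c j := (1 - q ^+ (2 * (m - j))) * (1 - q ^+ (2 * (m + j.+1))).
  transitivity (\sum_(j < m.+1) c j * F m j + q ^+ (2 * m) * \sum_(j < m.+1) U j).
    rewrite !mulr_sumr -big_split /=; apply: eq_bigr => j _; apply: step; first by rewrite -ltnS.
    have hj : (j <= m)%N by rewrite -ltnS.
    rewrite /c; have -> : q ^+ (2 * (m + j.+1)) = X * q ^+ (2 * j + 1).
      by rewrite /X -exprD; congr (_ ^+ _); lia.
    have -> : X = q ^+ (2 * (m - j)) * q ^+ (2 * j + 1).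
      by rewrite /X -exprD; congr (_ ^+ _); lia.
    by ring.
  (* [c m = 0] drops the last term; for [j <= n] the two factors of [c j] turn the [ipoch] factors
     of [F m j] into those of [F n j]. *)
  congr (_ + _); rewrite big_ord_recr /= {2}/c subnn muln0 expr0 subrr !mul0r addr0.
  apply: eq_bigr => j _; have hj : (j <= n)%N by rewrite -ltnS.
  rewrite /F /c.
  have -> : ipoch (n - j) = (1 - q ^+ (2 * (m - j))) * ipoch (m - j).
    by rewrite ipochS /m subSn.
  have -> : ipoch (n + j.+1) = (1 - q ^+ (2 * (m + j.+1))) * ipoch (m + j.+1).
    by rewrite ipochS.
  by ring.
rewrite -[LHS]/(iodd m.+1 ^+ 2) ioddS exprMn IH -/m.
rewrite -[X in X * _]/(\sum_(j < m) F n j) -key.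
rewrite mulrAC -exprMn hg expr1n mul1r //.
Qed.

Lemma zsum_fold (f : int -> R) : (forall j : nat, (N <= j)%N -> f j = 0 /\ f (Negz j) = 0) ->
  zsum N f = \sum_(j < N) (f j + f (Negz j)).
Proof.
move=> hf; have -> : zsum N f = \sum_(i <- iota 0 (zbox N)) (f (Posz i) + f (Negz i)).
  by rewrite /zsum big_cat !big_map big_split.
rewrite (_ : iota 0 (zbox N) = index_iota 0 (zbox N)); last by rewrite /index_iota subn0.
rewrite (@big_cat_nat _ _ _ N) //=; last by rewrite /zbox; lia.
rewrite [X in _ + X]big_nat_cond [X in _ + X]big1 ?addr0; first by rewrite big_mkord.
by move=> j; rewrite andbT => /andP[/hf [-> ->] _]; apply: addr0.
Qed.

Lemma mpoch0 : mpoch 0 = 1. Proof. by rewrite /mpoch big_ord0. Qed.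

(** For the unit pair the left side of [bailey] is its term [n = 0], namely 1, and the sum on the
    right is [phi(-q^2)] folded along [n -> -1 - n]. *)
Lemma phi_baileyC0 : phi N (- q ^+ 2) * baileyC 0 = 1.
Proof.
have N0 := nil_pos qN.
have := @bailey (fun j => (-1) ^+ j * q ^+ (j * j.-1) * (1 - q ^+ (4 * j + 2)))
  (fun n => (n == 0%N)%:R) (fun n => esym (unit_pair n)).
rewrite (bigD1 (Ordinal N0)) //= mpoch0 mul0n expr0 !mulr1 big1 ?addr0; last first.
  by move=> i hi; rewrite (_ : (i == 0%N :> nat) = false) ?mulr0 //; apply: negbTE.
move=> ->; rewrite mulrC; congr (_ * _).
rewrite phi_opp zsum_fold => [|j hj].
  apply: eq_bigr => j _; rewrite !qz_pow /qz /sg.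
  have -> : absz (Negz j) = (j.+1)%N by lia.
  have -> : absz (2%:Z * (Negz j * Negz j)) = (2 * (j.+1 * j.+1))%N by lia.
  have -> : absz (2%:Z * (j%:Z * j%:Z)) = (2 * (j * j))%N by lia.
  have -> : absz (j%:Z) = (j)%N by lia.
  have -> : q ^+ (2 * (j.+1 * j.+1)) = q ^+ (2 * (j * j)) * q ^+ (4 * j + 2).
    by rewrite -exprD; congr (_ ^+ _); lia.
  have e : q ^+ (j * j.+1) * q ^+ (j * j.-1) = q ^+ (2 * (j * j)).
    by rewrite -exprD; congr (_ ^+ _); case: (nat_of_ord j) => [|k] /=; lia.
  by rewrite -e exprS; ring.
have q2N := nil_pow qN (isT : 0 < 2)%N.
by split; rewrite (qz_small q2N) ?mulr0 //; have := sqz j; have := sqz (Negz j); lia.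
Qed.

(** [odd_pair] leaves [(1+y)/(1-y) = (1 + 2y + y^2)/(1-y^2)] with [y = q^(2j+1)]: [1] and [y^2] give
    the terms [j] and [-1-j] of [T(q^2)], and [2y] those of [q S(q^2)]. *)
Lemma phi_Bsum : phi N (- q ^+ 2) * Bsum = appellT N (q ^+ 2) + q * appellS N (q ^+ 2).
Proof.
have q2N := nil_pow qN (isT : 0 < 2)%N.
have -> : Bsum = baileyC 0 * \sum_(j < N) q ^+ (j * j.+1) *
    ((-1) ^+ j * q ^+ (j * j.+1) * (1 + q ^+ (2 * j + 1)) * g (2 * j + 1)).
  have h := (@bailey (fun j => (-1) ^+ j * q ^+ (j * j.+1) *
    (1 + q ^+ (2 * j + 1)) * g (2 * j + 1)) (fun n => iodd n.+1 ^+ 2) odd_pair).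
  by rewrite Bsum_eq -h; apply: eq_bigr => k _; rewrite [q ^+ _ * _]mulrC.
rewrite mulrA phi_baileyC0 mul1r.
rewrite /appellT /appellS -zsumMl -zsumD zsum_fold => [|j hj]; last first.
  by split; rewrite !(qfrac_small q2N) ?mulr0 ?addr0 //; case: ifP; have := sqz j;
    have := sqz (Negz j); lia.
apply: eq_bigr => j _.
have -> : Negz j = -1 - j%:Z by lia.
have -> : 2 * (-1 - j%:Z) + 1 = - (2 * j%:Z + 1) by ring.
rewrite !qfrac_neg ?odd_neq0 // sg_refl.
have -> : (-1 - j%:Z) * (-1 - j%:Z) + (-1 - j%:Z) + (2 * j%:Z + 1) =
  j%:Z * j%:Z + j%:Z + (2 * j%:Z + 1) by ring.
have -> : (-1 - j%:Z) * (-1 - j%:Z) + 2 * (-1 - j%:Z) + (2 * j%:Z + 1) = j%:Z * j%:Z + 2 * j%:Z by ring.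
rewrite /qfrac (_ : 0 < 2 * j%:Z + 1); last lia.
rewrite !qz_pow /qz /sg.
have -> : absz (2 * j%:Z + 1) = (2 * j + 1)%N by lia.
have -> : absz (j%:Z) = (j)%N by lia.
have -> : ginv N (q ^+ 2) (2 * j + 1) = ginv N q (2 * (2 * j + 1)).
  by apply: eq_bigr => i _; rewrite -exprM mulnA.
rewrite (@ginv_dvd _ N q qN 2 (2 * j + 1)) ?addn1 //.
set G := ginv N q _.
rewrite !big_ord_recr big_ord0 /= muln0 expr0 muln1 add0r.
set y := q ^+ (2 * j).+1.
have -> : (2 * (j * j + j) = j * j.+1 + j * j.+1)%N by lia.
have -> : (2 * (j * j + j + ((1 + 1) * j + 1)) =
  j * j.+1 + j * j.+1 + (2 * j).+1 + (2 * j).+1)%N by lia.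
have e : q * q ^+ (2 * (j * j + (1 + 1) * j)) = q ^+ (j * j.+1 + j * j.+1 + (2 * j).+1).
  by rewrite -exprS; congr (_ ^+ _); lia.
transitivity ((-1) ^+ j * (q ^+ (j * j.+1 + j * j.+1) * G) +
   (-1) ^+ j * (q * q ^+ (2 * (j * j + (1 + 1) * j))) * G *+ 2 +
   (-1) ^+ j * (q ^+ (j * j.+1 + j * j.+1 + (2 * j).+1 + (2 * j).+1) * G)); last by ring.
rewrite e.
by rewrite !exprD -/y; ring.
Qed.

End Bailey.

(** * Extraction of coefficients *)

Section Truncated.
Variable n : nat.
Let N := n.+1.
Definition trunc := {poly %/ ('X^(n.+1) : {poly int})}.
Implicit Types x y : trunc.

Definition cf x k : int := (x : {poly int})`_k.
Definition tX : trunc := in_qpoly 'X^(n.+1) 'X.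

Lemma cf_in_qpoly (p : {poly int}) k : (k < N)%N -> cf (in_qpoly 'X^(n.+1) p) k = p`_k.
Proof.
move=> hk; rewrite /cf /= mk_monic_Xn /=.
rewrite [in RHS](rdivp_eq (monicXn _ n.+1) p) coefD coefMXn.
by rewrite (_ : (k < n.+1)%N = true) ?add0r.
Qed.

Lemma in_qpolyK x : in_qpoly 'X^(n.+1) (x : {poly int}) = x.
Proof.
apply/val_inj => /=; rewrite rmodp_small //.
exact: size_mk_monic.
Qed.

Lemma cfD x y k : cf (x + y) k = cf x k + cf y k.
Proof. by rewrite /cf poly_of_qpolyD coefD. Qed.

Lemma cfM x y k : (k < N)%N -> cf (x * y) k = \sum_(i < k.+1) cf x i * cf y (k - i).
Proof.
move=> hk; rewrite -[x in LHS]in_qpolyK -[y in LHS]in_qpolyK -rmorphM cf_in_qpoly //.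
by rewrite coefM.
Qed.

Lemma cf0 k : cf 0 k = 0.
Proof. by rewrite /cf coef0. Qed.

Lemma cfN x k : cf (- x) k = - cf x k.
Proof. by apply/eqP; rewrite -addr_eq0 -cfD addNr cf0. Qed.

Lemma cfXn e k : (k < N)%N -> cf (tX ^+ e) k = (k == e)%:R.
Proof. by move=> hk; rewrite -rmorphXn cf_in_qpoly // coefXn. Qed.

Lemma cf1 k : (k < N)%N -> cf 1 k = (k == 0%N)%:R.
Proof. by move=> hk; rewrite -(expr0 tX) cfXn. Qed.

Lemma trunc_eq x y : (forall k, (k < N)%N -> cf x k = cf y k) -> x = y.
Proof.
move=> h; apply/val_inj/polyP => k /=; have [hk|hk] := ltnP k N; first exact: h.
have sz (z : trunc) : (size (z : {poly int}) <= k)%N.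
  have e : size (mk_monic ('X^(n.+1) : {poly int})) = n.+2.
    by rewrite mk_monic_Xn size_polyXn.
  have hz : (size (z : {poly int}) < n.+2)%N := leq_trans (size_mk_monic z) (eq_leq e).
  by rewrite ltnS in hz; apply: leq_trans hz hk.
by rewrite !nth_default.
Qed.

Lemma tX_nil : tX ^+ N = 0.
Proof. by apply: trunc_eq => k hk; rewrite cfXn // cf0 ltn_eqF. Qed.

Lemma cf_muln x m k : cf (x *+ m) k = cf x k *+ m.
Proof. by elim: m => [|m IH]; rewrite ?mulr0n ?cf0 // !mulrSr cfD IH. Qed.

Lemma trunc_two_reg x y : x *+ 2 = y *+ 2 -> x = y.
Proof.
move=> h; apply: trunc_eq => k _; have : cf (x *+ 2) k = cf (y *+ 2) k by rewrite h.
by rewrite !cf_muln; lia.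
Qed.

(* [x] only involves exponents congruent to [r] modulo [d]. *)
Definition gr d r x := forall k, (k < N)%N -> (k %% d != r %% d)%N -> cf x k = 0.

Lemma gr0 d r : gr d r 0. Proof. by move=> k _ _; apply: cf0. Qed.

Lemma grXn d e : gr d e (tX ^+ e).
Proof. by move=> k hk h; rewrite cfXn //; have [ke|//] := eqVneq k e; rewrite ke eqxx in h. Qed.

Lemma grD d r x y : gr d r x -> gr d r y -> gr d r (x + y).
Proof. by move=> hx hy k hk h; rewrite cfD hx ?hy ?addr0. Qed.

Lemma grN d r x : gr d r x -> gr d r (- x).
Proof. by move=> hx k hk h; rewrite cfN hx ?oppr0. Qed.

Lemma grM d r s x y : gr d r x -> gr d s y -> gr d (r + s) (x * y).
Proof.
move=> hx hy k hk h; rewrite cfM // big1 // => i _; have hi := ltn_ord i.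
have hik : (i <= k)%N by rewrite -ltnS.
have [expo1|expo1] := eqVneq (i %% d)%N (r %% d)%N; last first.
  by rewrite hx ?mul0r //; apply: leq_ltn_trans hk.
have [expo2|expo2] := eqVneq ((k - i) %% d)%N (s %% d)%N; last first.
  by rewrite hy ?mulr0 //; apply: leq_ltn_trans hk; apply: leq_subr.
by case/eqP: h; rewrite -(modnDm r) -expo1 -expo2 modnDm subnKC.
Qed.

Lemma gr_sum d r I (s : seq I) (f : I -> trunc) :
  (forall i, gr d r (f i)) -> gr d r (\sum_(i <- s) f i).
Proof.
by move=> h; elim: s => [|i s IH]; rewrite ?big_nil ?big_cons; [apply: gr0 | apply: grD].
Qed.

Lemma gr_mod d r s x : (r = s %[mod d])%N -> gr d r x -> gr d s x.
Proof. by move=> e hx k hk h; apply: hx; rewrite // e. Qed.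

Section Degree0.
Variable d : nat.
Local Notation deg0 := (gr d 0).

Lemma deg0_0 : deg0 0. Proof. exact: gr0. Qed.
Lemma deg0_1 : deg0 1. Proof. by rewrite -(expr0 tX); apply: grXn. Qed.
Lemma deg0M x y : deg0 x -> deg0 y -> deg0 (x * y). Proof. exact: (@grM d 0 0). Qed.
Lemma deg0X x k : deg0 x -> deg0 (x ^+ k).
Proof. by move=> h; elim: k => [|k IH]; rewrite ?exprS; [apply: deg0_1 | apply: deg0M]. Qed.
Lemma deg0Mn x k : deg0 x -> deg0 (x *+ k).
Proof. by move=> h; elim: k => [|k IH]; rewrite ?mulrS; [apply: deg0_0 | apply: grD]. Qed.
Lemma deg0_tXn k : (d %| k)%N -> deg0 (tX ^+ k).
Proof. by move=> h; apply: (@gr_mod _ k); [rewrite mod0n; apply/eqP | apply: grXn]. Qed.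

Variable z : trunc.
Hypothesis hz : deg0 z.

Lemma deg0_sg m : deg0 (sg _ m). Proof. by apply/deg0X/grN/deg0_1. Qed.
Lemma deg0_qz e : deg0 (qz z e). Proof. exact: deg0X. Qed.
Lemma deg0_ginv k : deg0 (ginv N z k). Proof. by apply: gr_sum => i; apply: deg0X. Qed.
Lemma deg0_qfrac e m : deg0 (qfrac N z e m).
Proof.
by rewrite /qfrac; case: ifP => _; [|apply: grN]; apply: deg0M; rewrite ?deg0_qz //;
  [apply: deg0_qz | apply: deg0_ginv | apply: deg0_qz | apply: deg0_ginv].
Qed.
Lemma deg0_zsum f : (forall m, deg0 (f m)) -> deg0 (zsum N f). Proof. exact: gr_sum. Qed.
Lemma deg0_phi : deg0 (phi N z). Proof. by apply: deg0_zsum => m; apply: deg0_qz. Qed.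
Lemma deg0_psi : deg0 (psi N z). Proof. by apply: deg0_zsum => m; apply: deg0_qz. Qed.
Lemma deg0_appellS : deg0 (appellS N z).
Proof. by apply: deg0_zsum => m; apply: deg0M; [apply: deg0_sg | apply: deg0_qfrac]. Qed.
Lemma deg0_phiW : deg0 (phiW N z).
Proof. by apply: deg0_zsum => m; apply: deg0M; [apply: deg0_sg | apply: deg0_qz]. Qed.
Lemma deg0_psiA : deg0 (psiA N z).
Proof. by apply: grD; apply: deg0_zsum => m; apply: deg0_qz. Qed.
Lemma deg0_lambert j c k : deg0 (lambert N z j c k).
Proof. by apply: deg0_zsum => m; apply: deg0M; [apply: deg0_sg | apply: deg0_qfrac]. Qed.

End Degree0.

Definition dvd_on (c : int) d r x := forall k, (k < N)%N -> (k = r %[mod d])%N -> (c %| cf x k)%Z.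

Lemma dvd_onD c d r x y : dvd_on c d r x -> dvd_on c d r y -> dvd_on c d r (x + y).
Proof. by move=> hx hy k hk h; rewrite cfD rpredD ?hx ?hy. Qed.

Lemma dvd_on_muln (m : nat) d r x : dvd_on m d r (x *+ m).
Proof. by move=> k hk h; rewrite cf_muln -mulr_natr dvdz_mull // natz. Qed.

Lemma dvd_on_gr c d e r s x : (e %| d)%N -> (r %% e != s %% e)%N -> gr e s x -> dvd_on c d r x.
Proof.
move=> ed rs hx k hk h; rewrite hx ?dvdz0 //.
by rewrite -(modn_dvdm k ed) h modn_dvdm.
Qed.

(** Multiplication by a series in [q^d] does not mix classes modulo [d]; with constant term 1 it can
    be undone by strong induction on the exponent. *)
Lemma dvd_on_extract c d r U x : gr d 0 U -> cf U 0 = 1 -> dvd_on c d r (U * x) -> dvd_on c d r x.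
Proof.
move=> hU U1 h k; elim/ltn_ind: k => k IH hk e.
have := h k hk e; rewrite cfM // big_ord_recl /= U1 mul1r subn0.
rewrite rpredDr //; apply: rpred_sum => i _; rewrite /bump /= add1n.
have hi := ltn_ord i.
have [h0|h0] := eqVneq (i.+1 %% d)%N 0%N; last first.
  by rewrite hU ?mul0r ?rpred0 ?mod0n //; apply: leq_ltn_trans hk.
apply: dvdz_mull; apply: IH.
- by rewrite -subn_gt0 subKn.
- by apply: leq_ltn_trans hk; apply: leq_subr.
- by rewrite -e -[in RHS](subnK hi) -modnDmr h0 addn0.
Qed.

Lemma cf_unit z x : cf z 0 = 0 -> cf (1 + z * x) 0 = 1.
Proof. by move=> h; rewrite cfD cf1 // cfM // big_ord1 h mul0r addr0. Qed.

Lemma cfM0 x y : cf (x * y) 0 = cf x 0 * cf y 0.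
Proof. by rewrite cfM // big_ord1. Qed.

Lemma cf_phi z : cf z 0 = 0 -> cf (phi N z) 0 = 1.
Proof.
move=> h; have [x ->] : exists x, phi N z = 1 + z * x; last exact: cf_unit.
by apply: zsum_const1 => // m hm; nia.
Qed.

Lemma Bsum_cf : cf (Bsum N tX) n = b n.
Proof.
rewrite /b -(@cf_in_qpoly _ n) // ; congr (cf _ n).
rewrite rmorph_sum; apply: eq_bigr => k _.
rewrite !rmorphM rmorphXn; congr (_ * _ * _).
  rewrite rmorph_prod; apply: eq_bigr => j _.
  by rewrite rmorphD rmorph1 rmorphXn.
rewrite rmorph_prod; apply: eq_bigr => j _.
by rewrite /geom_trunc rmorph_sum; apply: eq_bigr => i _; rewrite rmorphXn.
Qed.

End Truncated.

(** * The congruences *)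

Section Combos.
Variables (R : comNzRingType) (N : nat) (y : R).
Hypothesis yN : y ^+ N = 0.
Local Notation Q := (y ^+ 3).
Local Notation a := (phi N (- Q ^+ 3)).
Local Notation w := (phiW N Q).
Local Notation A := (psiA N Q).
Local Notation P := (psi N (Q ^+ 3)).
Let QN : Q ^+ N = 0 := nil_pow yN (isT : 0 < 3)%N.

(* With [phi N (- y) = a - 2 y w], multiplication by [phi_conj] turns [phi N (- y)] into
   [a^3 - (2 y w)^3], a series in [y^3]. *)
Definition phi_conj := a ^+ 2 + (a * y * w) *+ 2 + (y ^+ 2 * w ^+ 2) *+ 4.
Definition phi_norm := a ^+ 3 - (Q * w ^+ 3) *+ 8.

Lemma phi_conj_phi : phi_conj * phi N (- y) = phi_norm.
Proof. by rewrite (phi_dissect yN) /phi_conj /phi_norm; ring. Qed.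

Lemma phi_conj_psi2 : phi_conj * psi N y ^+ 2 =
  (A ^+ 2 * a ^+ 2 + Q * ((A * P * w ^+ 2) *+ 8 + (P ^+ 2 * a * w) *+ 2)) +
  y * ((A ^+ 2 * a * w) *+ 2 + (A * P * a ^+ 2) *+ 2 + (Q * P ^+ 2 * w ^+ 2) *+ 4) +
  (y ^+ 2 * (A * w) ^+ 2) *+ 9.
Proof.
rewrite (psi_dissect yN) /phi_conj.
transitivity (
  (A ^+ 2 * a ^+ 2 + Q * ((A * P * w ^+ 2) *+ 8 + (P ^+ 2 * a * w) *+ 2)) +
  y * ((A ^+ 2 * a * w) *+ 2 + (A * P * a ^+ 2) *+ 2 + (Q * P ^+ 2 * w ^+ 2) *+ 4) +
  y ^+ 2 * ((A * w) ^+ 2 *+ 4 + (A * w) * (a * P) *+ 4 + (a * P) ^+ 2)).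
  by ring.
by rewrite -(psiA_phiW QN); ring.
Qed.

(** The [y^2] part is [3 (2Aw + aP)^2 (a^2 A + 4 Q P w^2)], and [aP = Aw] makes the square
    [9 (Aw)^2]. *)
Lemma phi_conj_psi3 : phi_conj ^+ 2 * psi N y ^+ 3 =
  (a ^+ 4 * A ^+ 3 + Q * (a * w ^+ 3 * A ^+ 3 *+ 16 + a ^+ 2 * w ^+ 2 * A ^+ 2 * P *+ 36 +
     a ^+ 3 * w * A * P ^+ 2 *+ 12 + a ^+ 4 * P ^+ 3) +
   Q ^+ 2 * (w ^+ 4 * A * P ^+ 2 *+ 48 + a * w ^+ 3 * P ^+ 3 *+ 16)) +
  y * (a ^+ 3 * w * A ^+ 3 *+ 4 + a ^+ 4 * A ^+ 2 * P *+ 3 +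
   Q * (w ^+ 4 * A ^+ 3 *+ 16 + a * w ^+ 3 * A ^+ 2 * P *+ 48 +
     a ^+ 2 * w ^+ 2 * A * P ^+ 2 *+ 36 + a ^+ 3 * w * P ^+ 3 *+ 4) +
   Q ^+ 2 * (w ^+ 4 * P ^+ 3 *+ 16)) +
  (y ^+ 2 * (A * w) ^+ 2 * (a ^+ 2 * A + Q * P * w ^+ 2 *+ 4)) *+ 27.
Proof.
rewrite (psi_dissect yN) /phi_conj.
pose K2 := A * w; pose K3 := a * P.
transitivity (
  (a ^+ 4 * A ^+ 3 + Q * (a * w ^+ 3 * A ^+ 3 *+ 16 + a ^+ 2 * w ^+ 2 * A ^+ 2 * P *+ 36 +
     a ^+ 3 * w * A * P ^+ 2 *+ 12 + a ^+ 4 * P ^+ 3) +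
   Q ^+ 2 * (w ^+ 4 * A * P ^+ 2 *+ 48 + a * w ^+ 3 * P ^+ 3 *+ 16)) +
  y * (a ^+ 3 * w * A ^+ 3 *+ 4 + a ^+ 4 * A ^+ 2 * P *+ 3 +
   Q * (w ^+ 4 * A ^+ 3 *+ 16 + a * w ^+ 3 * A ^+ 2 * P *+ 48 +
     a ^+ 2 * w ^+ 2 * A * P ^+ 2 *+ 36 + a ^+ 3 * w * P ^+ 3 *+ 4) +
   Q ^+ 2 * (w ^+ 4 * P ^+ 3 *+ 16)) +
  y ^+ 2 * ((a ^+ 2 * A) * (K2 ^+ 2 *+ 12 + K2 * K3 *+ 12 + K3 ^+ 2 *+ 3) +
    (Q * P * w ^+ 2) * (K2 ^+ 2 *+ 48 + K2 * K3 *+ 48 + K3 ^+ 2 *+ 12))).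
  by rewrite /K2 /K3; ring.
by rewrite /K2 /K3 -(psiA_phiW QN); ring.
Qed.

(** The two Lambert identities rewrite the [y] part as [a w] times a combination in which
    [lambert 6 3 2] cancels and the remaining coefficients are 6. *)
Lemma phi_conj_appellS : phi_conj * appellS N y =
  (a ^+ 2 * (lambert N Q 2 1 0 *+ 2 - (lambert N Q 4 3 1 + lambert N Q 6 3 2 + lambert N Q 8 3 3)) +
   Q * (a * w * lambert N Q 6 1 0 *+ 4 + w ^+ 2 * lambert N Q 4 1 0 *+ 8)) +
  (y * (a * w * (lambert N Q 2 1 0 + Q * lambert N Q 4 3 0))) *+ 6 +
  y ^+ 2 * (a ^+ 2 * lambert N Q 6 1 0 *+ 2 + a * w * lambert N Q 4 1 0 *+ 4 +
    w ^+ 2 * (lambert N Q 2 1 0 *+ 2 -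
      (lambert N Q 4 3 1 + lambert N Q 6 3 2 + lambert N Q 8 3 3)) *+ 4).
Proof.
have z431 : lambert N Q 4 3 1 = Q * lambert N Q 4 3 0.
  rewrite lambert_mul // => s; rewrite /valid; have := sqz s; have := sqz (s + 1); case: ifP; lia.
have z833 : lambert N Q 8 3 3 = Q * lambert N Q 4 3 0.
  rewrite -lambert_refl lambert_mul // => s; rewrite /valid; have := sqz s; have := sqz (s + 1).
  by case: ifP; lia.
have expo1 : w * lambert N Q 6 1 0 = a * lambert N Q 4 3 0.
  by rewrite (lambert_identity1 QN) lambert_refl.
have expo2 := lambert_identity2 QN; rewrite z431 in expo2.
rewrite (appellS_dissect yN) /phi_conj z431 z833.
set z21 := lambert N Q 2 1 0 in expo1 expo2 *; set z63 := lambert N Q 6 3 2 in expo1 expo2 *.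
set z41 := lambert N Q 4 1 0 in expo1 expo2 *; set z61 := lambert N Q 6 1 0 in expo1 expo2 *.
set z43 := lambert N Q 4 3 0 in expo1 expo2 *.
set s0 := z21 *+ 2 - _.
transitivity ((a ^+ 2 * s0 + Q * (a * w * z61 *+ 4 + w ^+ 2 * z41 *+ 8)) +
  y * (a * (a * z41) *+ 2 + a * w * s0 *+ 2 + Q * w * (w * z61) *+ 8) +
  y ^+ 2 * (a ^+ 2 * z61 *+ 2 + a * w * z41 *+ 4 + w ^+ 2 * s0 *+ 4)).
  by ring.
by congr (_ + _ + _); rewrite expo1 expo2 /s0; ring.
Qed.

End Combos.

(** Folding along [n -> -1 - n] pairs [j^2] with [(j+1)^2] rather than with itself; the discrepancy
    telescopes to [-1]. *)
Lemma phi_two (R : comNzRingType) (N : nat) (q : R) :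
  q ^+ N = 0 -> exists s, phi N q = 1 + s *+ 2.
Proof.
move=> qN; pose f j := q ^+ (j * j).
exists (\sum_(j < N) f j - 1).
have fN : f N = 0 by apply: (expr_small qN); rewrite leq_pmulr // (nil_pos qN).
have tel : \sum_(j < N) (f j.+1 - f j) = - 1.
  by rewrite -(big_mkord xpredT (fun j => f j.+1 - f j)) telescope_sumr // fN sub0r.
transitivity (\sum_(j < N) (f j + f j.+1)).
  rewrite /phi zsum_fold => [|j hj].
    by apply: eq_bigr => j _; rewrite /f /qz; congr (_ ^+ _ + _ ^+ _); lia.
  by split; rewrite (qz_small qN) //; have := sqz j; have := sqz (Negz j); lia.
transitivity ((\sum_(j < N) f j) *+ 2 + \sum_(j < N) (f j.+1 - f j)).
  by rewrite -sumrMnl -big_split /=; apply: eq_bigr => j _; ring.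
by rewrite tel; ring.
Qed.

Section Congruences.
Variable n : nat.
Local Notation N := n.+1.
Local Notation X := (tX n).
Local Notation y := (X ^+ 2).
Local Notation B := (Bsum N X).
Let XN : X ^+ N = 0 := tX_nil n.
Let yN : y ^+ N = 0 := nil_pow XN (isT : 0 < 2)%N.
Let y2N : (y ^+ 2) ^+ N = 0 := nil_pow yN (isT : 0 < 2)%N.

Lemma cf_exp0 (x : trunc n) k : cf (x ^+ k) 0 = cf x 0 ^+ k.
Proof. by elim: k => [|k IH]; [rewrite !expr0 cf1 | rewrite exprS cfM0 IH -exprS]. Qed.

Lemma cf_X0 : cf X 0 = 0.
Proof. by rewrite -[X]expr1 cfXn. Qed.

Lemma cf_phiN (z : trunc n) : cf z 0 = 0 -> cf (phi N (- z)) 0 = 1.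
Proof. by move=> h; rewrite cf_phi // cfN h oppr0. Qed.

Lemma cf_phi_norm (z : trunc n) : cf z 0 = 0 -> cf (phi_norm N z) 0 = 1.
Proof.
move=> h; have h9 : cf ((z ^+ 3) ^+ 3) 0 = 0 by rewrite !cf_exp0 h !expr0n.
by rewrite /phi_norm cfD cfN cf_muln cf_exp0 (cf_phiN h9) cfM0 (cf_exp0 z) h expr1n expr0n
  mul0r mul0rn subr0.
Qed.

Lemma gr_X d : gr d 1 X. Proof. by rewrite -[X]expr1; apply: grXn. Qed.

Lemma X_y2 : X * y ^+ 2 = X ^+ 5.
Proof. by rewrite -exprM -exprS. Qed.

Lemma phi_B : phi N (- y) * B = psi N y ^+ 2 + X * appellS N y.
Proof. by rewrite (phi_Bsum XN) (appellT_psi (@trunc_two_reg n) yN). Qed.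

Ltac deg0_tac := repeat match goal with
  | h : gr ?d 0 ?x |- gr ?d 0 ?x => exact: h
  | |- gr _ _ (_ + _) => apply: grD
  | |- gr _ _ (- _) => apply: grN
  | |- gr _ 0 (phi _ _) => apply: deg0_phi
  | |- gr _ 0 (psi _ _) => apply: deg0_psi
  | |- gr _ 0 (appellS _ _) => apply: deg0_appellS
  | |- gr _ 0 (phiW _ _) => apply: deg0_phiW
  | |- gr _ 0 (psiA _ _) => apply: deg0_psiA
  | |- gr _ 0 (lambert _ _ _ _ _) => apply: deg0_lambert
  | |- gr _ 0 (phi_conj _ _) => rewrite /phi_conj
  | |- gr _ 0 (phi_norm _ _) => rewrite /phi_norm
  | |- gr _ 0 (_ ^+ _) => apply: deg0X
  | |- gr _ 0 (_ *+ _) => apply: deg0Mn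
  | |- gr _ 0 (_ * _) => apply: deg0M
  | |- gr _ 0 1 => apply: deg0_1
  end.

(** The multiplier is [phi(y) phi(-y)], leaving [phi(y)^2 psi(y^2)] plus odd powers of [q];
    [psi(y^2)] is a series in [q^4], so the class 2 modulo 4 only sees the multiple of 4 in
    [phi(y)^2 - 1]. *)
Lemma B_dvd4 : dvd_on 4 4 2 B.
Proof.
have y0 : gr 2 0 y by apply: deg0_tXn.
have yy0 : gr 4 0 (y ^+ 2) by rewrite -exprM; apply: deg0_tXn.
apply: (@dvd_on_extract _ _ _ _ (phi N (- y ^+ 2) ^+ 2)).
- by deg0_tac.
- by rewrite cf_exp0 cf_phiN ?expr1n // -exprM cf_exp0 cf_X0 expr0n.
have [s hs] := phi_two yN.
have -> : phi N (- y ^+ 2) ^+ 2 * B =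
    psi N (y ^+ 2) + ((s + s ^+ 2) * psi N (y ^+ 2)) *+ 4 + X * (phi N y * appellS N y).
  rewrite -(phi_mul_opp yN) -mulrA phi_B (psi_sqr yN).
  transitivity (phi N y ^+ 2 * psi N (y ^+ 2) + X * (phi N y * appellS N y)); first by ring.
  by rewrite {1}hs; ring.
apply: dvd_onD; [apply: dvd_onD|].
- apply: (@dvd_on_gr _ _ _ 4 _ 0) => //; deg0_tac.
- exact: dvd_on_muln.
- by apply: (@dvd_on_gr _ _ _ 2 _ (1 + 0)) => //; apply: grM; [apply: gr_X | deg0_tac].
Qed.

Lemma phi_norm_B : phi_norm N y * B = phi_conj N y * psi N y ^+ 2 + X * (phi_conj N y * appellS N y).
Proof. by rewrite -(phi_conj_phi yN) -mulrA phi_B; ring. Qed.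

Lemma B_dvd9 : dvd_on 9 6 4 B.
Proof.
have y0 : gr 2 0 y by apply: deg0_tXn.
have Q0 : gr 6 0 (y ^+ 3) by rewrite -exprM; apply: deg0_tXn.
have y2 : gr 6 2 y by apply: grXn.
apply: (@dvd_on_extract _ _ _ _ (phi_norm N y)).
- by deg0_tac.
- by rewrite cf_phi_norm // cf_exp0 cf_X0.
rewrite phi_norm_B (phi_conj_psi2 yN); apply: dvd_onD; first apply: dvd_onD; first apply: dvd_onD.
- by apply: (@dvd_on_gr _ _ _ 6 _ 0) => //; deg0_tac.
- by apply: (@dvd_on_gr _ _ _ 6 _ (2 + 0)) => //; apply: grM => //; deg0_tac.
- exact: dvd_on_muln.
- by apply: (@dvd_on_gr _ _ _ 2 _ (1 + 0)) => //; apply: grM; [apply: gr_X | deg0_tac].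
Qed.

Lemma B_dvd6 : dvd_on 6 6 3 B.
Proof.
have y0 : gr 2 0 y by apply: deg0_tXn.
have Q0 : gr 6 0 (y ^+ 3) by rewrite -exprM; apply: deg0_tXn.
apply: (@dvd_on_extract _ _ _ _ (phi_norm N y)).
- by deg0_tac.
- by rewrite cf_phi_norm // cf_exp0 cf_X0.
rewrite phi_norm_B (phi_conj_appellS yN); apply: dvd_onD.
  by apply: (@dvd_on_gr _ _ _ 2 _ 0) => //; deg0_tac.
rewrite 2!mulrDr; apply: dvd_onD; first apply: dvd_onD.
- by apply: (@dvd_on_gr _ _ _ 6 _ (1 + 0)) => //; apply: grM; [apply: gr_X | deg0_tac].
- by rewrite mulrnAr; apply: dvd_on_muln.
- rewrite mulrA X_y2.
  by apply: (@dvd_on_gr _ _ _ 6 _ (5 + 0)) => //; apply: grM; [apply: grXn | deg0_tac].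
Qed.

Lemma gr_phiS_odd : gr 4 2 (phiS_odd N y).
Proof.
apply: gr_sum => M; apply: gr_sum => k; apply: (@grM _ _ 0 2); first exact: deg0_sg.
have h (e : int) j : (`|e| %% 2 = 1)%N -> gr 4 2 (qz y e * ginv N y (2 * j)).
  move=> he; apply: (@grM _ _ 2 0).
    rewrite /qz -exprM; apply: (@gr_mod _ _ (2 * `|e|)); last exact: grXn.
    have -> : (2 * `|e| = (`|e| %/ 2) * 4 + 2)%N by lia.
    by rewrite modnMDl.
  apply: gr_sum => i; rewrite -exprM; apply: deg0_tXn.
  have -> : (2 * (2 * j * i) = 4 * (j * i))%N by lia.
  exact: dvdn_mulr.
rewrite /qfrac abszM; case: ifP => _; [|apply: grN]; apply: h; lia.
Qed.

(** The norm is squared because [phi(-y^2)^2 = phi(y) phi(-y)]: the factor [phi(-y)] acts on [B],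
    and [phi(y)] then acts on [S]. Here [q * phiS_odd] lives in the class 3 modulo 4, missing
    [12n + 9]; the factor 2 before [psi(y^2)^3] and the 27 of [phi_conj_psi3] give 54. *)
Lemma B_dvd54 : dvd_on 54 12 9 B.
Proof.
have y0 : gr 2 0 y by apply: deg0_tXn.
have v0 : gr 4 0 (y ^+ 2) by rewrite -exprM; apply: deg0_tXn.
have Q0 : gr 12 0 ((y ^+ 2) ^+ 3) by rewrite -!exprM; apply: deg0_tXn.
apply: (@dvd_on_extract _ _ _ _ (phi_norm N (y ^+ 2) ^+ 2)).
- by deg0_tac.
- by rewrite cf_exp0 cf_phi_norm ?expr1n // -exprM cf_exp0 cf_X0.
have -> : phi_norm N (y ^+ 2) ^+ 2 * B = phi_conj N (y ^+ 2) ^+ 2 * phi N y * psi N y ^+ 2 +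
    (X * (phi_conj N (y ^+ 2) ^+ 2 * phiS_odd N y)) *+ 2 +
    (X * (phi_conj N (y ^+ 2) ^+ 2 * psi N (y ^+ 2) ^+ 3)) *+ 2.
  rewrite -(phi_conj_phi y2N) exprMn -(phi_mul_opp yN).
  transitivity (phi_conj N (y ^+ 2) ^+ 2 * phi N y * (phi N (- y) * B)); first by ring.
  rewrite phi_B.
  transitivity (phi_conj N (y ^+ 2) ^+ 2 * phi N y * psi N y ^+ 2 +
    X * (phi_conj N (y ^+ 2) ^+ 2 * (phi N y * appellS N y))); first by ring.
  by rewrite (phi_appellS (@trunc_two_reg n) yN); ring.
apply: dvd_onD; first apply: dvd_onD.
- by apply: (@dvd_on_gr _ _ _ 2 _ 0) => //; deg0_tac.
- apply: (@dvd_on_gr _ _ _ 4 _ (1 + (0 + 2))) => //; rewrite mulr2n.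
  by apply: grD; apply: grM; try exact: gr_X; apply: grM; try exact: gr_phiS_odd; deg0_tac.
rewrite (phi_conj_psi3 y2N) 2!mulrDr 2!mulrnDl; apply: dvd_onD; first apply: dvd_onD.
- apply: (@dvd_on_gr _ _ _ 12 _ (1 + 0)) => //; rewrite mulr2n.
  by apply: grD; apply: grM; try exact: gr_X; deg0_tac.
- apply: (@dvd_on_gr _ _ _ 12 _ (5 + 0)) => //; rewrite mulr2n mulrA X_y2.
  by apply: grD; apply: grM; try exact: grXn; deg0_tac.
- by rewrite mulrnAr -mulrnA; apply: dvd_on_muln.
Qed.

End Congruences.

Local Close Scope ring_scope.

Theorem theorem1p3 (n : nat) :
  (6 %| b (6 * n + 3))%Z /\ (36 %| b (36 * n + 22))%Z /\ (54 %| b (12 * n + 9))%Z.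
Proof.
split; last split.
- rewrite -Bsum_cf; apply: B_dvd6 => //; lia.
(* [36n + 22] is 2 modulo 4 and 4 modulo 6. *)
- rewrite -Bsum_cf; set x := cf _ _; suff: (4%:Z * 9%:Z %| x)%Z by [].
  rewrite Gauss_dvdz //; apply/andP; split.
    by apply: B_dvd4 => //; lia.
  by apply: B_dvd9 => //; lia.
- rewrite -Bsum_cf; apply: B_dvd54 => //; lia.
Qed.
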